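(* Let $d\ge 3$, let $M$ be a measurable space, and let $X=(X_v)_{v\in V(T_d)}$ be a factor of i.i.d. process on $M^{V(T_d)}$. Let $V_1,V_2\subset V(T_d)$ be arbitrary (possibly infinite) subsets of the vertex set, and for $i=1,2$ let $h_i\colon M^{V_i}\to\mathbb{R}$ be a measurable function; write $h_i(X)$ for $h_i\big((X_v)_{v\in V_i}\big)$. Let $k$ denote the distance of the convex hulls of $V_1$ and $V_2$, and assume that $k$ is positive. If $h_1(X)$ and $h_2(X)$ have finite variances, then $$\left|\operatorname{corr}\big(h_1(X),h_2(X)\big)\right|\le k(d-1)\left(\frac{1}{\sqrt{d-1}}\right)^k .$$
   Context: $T_d$ is the infinite $d$-regular tree with vertex set $V(T_d)$ and automorphism group $\operatorname{Aut}(T_d)$. For a measurable space $M$, the space $M^{V(T_d)}$ carries the product $\sigma$-algebra, and $\operatorname{Aut}(T_d)$ acts on it by $(\gamma\cdot\omega)(v)=\omega(\gamma^{-1}v)$. A measurable map $F\colon[0,1]^{V(T_d)}\to M^{V(T_d)}$ is a factor if it is $\operatorname{Aut}(T_d)$-equivariant, i.e. commutes with the $\operatorname{Aut}(T_d)$-actions. A factor of i.i.d. process on $M^{V(T_d)}$ is $X=F(Z)$, where $F$ is such a factor and $Z=(Z_v)_{v\in V(T_d)}$ is a collection of independent random variables, each uniformly distributed on $[0,1]$; $X=(X_v)_{v\in V(T_d)}$ is viewed as a collection of $M$-valued random variables. The convex hull of $V_i$ is the smallest connected subgraph of $T_d$ containing $V_i$. The distance of two subgraphs is the minimum graph distance in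 $T_d$ between a vertex of one and a vertex of the other. The correlation is $\operatorname{corr}(U,W)=\operatorname{cov}(U,W)/\sqrt{\operatorname{var}(U)\operatorname{var}(W)}$, and it is $0$ by definition if one of the variances is $0$. *)

(* Defs.v *)
From HB Require Import structures.
From mathcomp Require Import all_boot all_order all_algebra.
From mathcomp Require Import all_classical all_reals all_analysis.

Set Implicit Arguments.
Unset Strict Implicit.
Unset Printing Implicit Defensive.

Import Order.TTheory GRing.Theory Num.Theory.

Local Open Scope classical_set_scope.
Local Open Scope ring_scope.

(** Graphs are given by their adjacency relation; a walk from [x] to [y] of
    length [size p] is a sequence [p] with [path e x p] and [last x p = y]. *)

Section graphs.
Context {V : choiceType}.

Definition connected_on (D : set V) (r : rel V) : Prop :=
  forall x y, D x -> D y -> exists2 p : seq V, path r x p & last x p = y.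

(* Cycles of length at most 2 are excluded: a cycle of length 2 merely
   traverses one edge back and forth. *)
Definition acyclic_graph (e : rel V) : Prop :=
  forall c : seq V, (2 < size c)%N -> ~ ucycle e c.

Definition regular_graph (d : nat) (e : rel V) : Prop :=
  forall x, exists s : seq V, [/\ uniq s, size s = d & e x =i s].

(* Up to isomorphism T_d is the only such graph. *)
Definition is_regular_tree (d : nat) (e : rel V) : Prop :=
  [/\ [set: V] !=set0, symmetric e & irreflexive e] /\
  [/\ connected_on setT e, acyclic_graph e & regular_graph d e].

Definition is_graph_dist (e : rel V) (x y : V) (n : nat) : Prop :=
  (exists p : seq V, [/\ path e x p, last x p = y & size p = n]) /\
  (forall p : seq V, path e x p -> last x p = y -> (n <= size p)%N).

Record graph_aut (e : rel V) := GraphAut {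
  aut_fun :> V -> V;
  aut_inv : V -> V;
  aut_funK : cancel aut_fun aut_inv;
  aut_invK : cancel aut_inv aut_fun;
  aut_adj : forall x y, e (aut_fun x) (aut_fun y) = e x y }.

Definition aut_act (e : rel V) (S : Type) (g : graph_aut e) (w : V -> S) :
    V -> S :=
  fun v => w (aut_inv g v).

Record subgraph (e : rel V) := Subgraph {
  sg_vert : set V;
  sg_edge : rel V;
  sg_edge_sym : symmetric sg_edge;
  sg_edge_sub : forall x y, sg_edge x y -> e x y;
  sg_edge_ends : forall x y, sg_edge x y -> sg_vert x /\ sg_vert y }.

Definition sg_connected (e : rel V) (H : subgraph e) : Prop :=
  connected_on (sg_vert H) (sg_edge H).

Definition sg_le (e : rel V) (H H' : subgraph e) : Prop :=
  sg_vert H `<=` sg_vert H' /\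
  (forall x y, sg_edge H x y -> sg_edge H' x y).

Definition is_convex_hull (e : rel V) (A : set V) (H : subgraph e) : Prop :=
  [/\ sg_connected H, A `<=` sg_vert H &
      forall H' : subgraph e,
        sg_connected H' -> A `<=` sg_vert H' -> sg_le H H'].

Definition is_subgraph_dist (e : rel V) (H1 H2 : subgraph e) (k : nat) : Prop :=
  (exists x y, [/\ sg_vert H1 x, sg_vert H2 y & is_graph_dist e x y k]) /\
  (forall x y n, sg_vert H1 x -> sg_vert H2 y -> is_graph_dist e x y n ->
     (k <= n)%N).

End graphs.

Definition cylinders (I : Type) dM (M : measurableType dM) :
    set_system (I -> M) :=
  \bigcup_(i in [set: I])
    preimage_set_system setT (fun w : I -> M => w i) measurable.

(* M^I with the product sigma-algebra. *)
Definition product_space (I : Type) dM (M : measurableType dM) :=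
  g_sigma_algebraType (@cylinders I dM M).

Definition coord_restrict (V : Type) (A : set V) dM (M : measurableType dM)
    (w : product_space V M) : product_space A M :=
  fun v : A => w (val v).

Section unit_interval.
Variable R : realType.

Definition unit_itv : Type := {x : R | 0 <= x <= 1}.

HB.instance Definition _ := Choice.on unit_itv.

Let unit_itv0_subproof : 0 <= (0 : R) <= 1.
Proof. by rewrite lexx ler01. Qed.

HB.instance Definition _ :=
  isPointed.Build unit_itv (exist _ 0 unit_itv0_subproof).

Definition unit_itv_val (x : unit_itv) : R := sval x.

(* [0, 1] with the Borel sigma-algebra (the trace of that of R). *)
Definition I01 := g_sigma_algebra_preimageType unit_itv_val.

End unit_interval.

Arguments coord_restrict {V} A {dM M} w.

Section iid.
Context {R : realType} {dO : measure_display} {Omega : measurableType dO}.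
Variable P : probability Omega R.

Definition mutually_independent (I : choiceType) dE (E : measurableType dE)
    (Z : I -> {RV P >-> E}) : Prop :=
  forall (s : seq I) (B : I -> set E), uniq s ->
    (forall i, i \in s -> measurable (B i)) ->
    P (\bigcap_(i in [set` s]) (Z i @^-1` B i)) =
    (\prod_(i <- s) P (Z i @^-1` B i))%E.

Definition uniform_on_I01 (U : {RV P >-> I01 R}) : Prop :=
  forall B : set R, measurable B ->
    distribution P U (@unit_itv_val R @^-1` B) = uniform_prob (@ltr01 R) B.

Definition iid_uniform (I : choiceType) (Z : I -> {RV P >-> I01 R}) : Prop :=
  mutually_independent Z /\ (forall i, uniform_on_I01 (Z i)).

Definition is_factor (V : choiceType) (e : rel V) dM (M : measurableType dM)
    (F : product_space V (I01 R) -> product_space V M) : Prop :=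
  measurable_fun setT F /\
  (forall (g : graph_aut e) (w : product_space V (I01 R)),
     F (aut_act g w) = aut_act g (F w)).

Definition is_factor_of_iid (V : choiceType) (e : rel V) dM
    (M : measurableType dM) (X : Omega -> product_space V M) : Prop :=
  exists (F : product_space V (I01 R) -> product_space V M)
         (Z : V -> {RV P >-> I01 R}),
    [/\ is_factor e F, iid_uniform Z &
        forall t, X t = F (fun v => Z v t)].

Definition corr (U W : Omega -> R) : R :=
  if ('V_P[U] == 0%E) || ('V_P[W] == 0%E) then 0
  else fine (covariance P U W) / Num.sqrt (fine 'V_P[U] * fine 'V_P[W]).

End iid.

(* Main.v *)
Require Import Defs.
From mathcomp Require Import all_boot all_order all_algebra.
From mathcomp Require Import zify ring lra finmap.
From mathcomp Require Import all_classical all_reals all_analysis.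
From mathcomp Require Import measurable_realfun.

(** Write [q = d - 1] and let [u 0, ..., u k] be the path between the convex
    hulls. As [X] is a factor of the i.i.d. field [Z], [h1 (X)] is a function
    [f1] of [Z], and equivariance makes [f1] invariant under the automorphisms
    of the tree that fix [V1] pointwise. By [connected_side] these include all
    automorphisms that only move the component of [u 1] in the tree without the
    edge [u 0 - u 1]. The same holds for [f2 = h2 (X)] at the other end of the
    path.

    Both functions, centered, are expanded in the Walsh functions of the binary
    digits of [Z], which form an orthonormal basis of the square-integrable
    functions of [Z] ([walsh_orthonormal], [walsh_dense]). This basis is indexed
    by finite sets [T] of pairs (vertex, digit), and an automorphism permutes it,
    so that invariance of [f1] becomes invariance of its coefficients [c1]
    ([fourier_coef_translate]). The covariance is the sum of [c1 T * c2 T] over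
    the nonempty [T].

    Each [T] is distributed over the layers [B 0, ..., B k] of the tree, where
    [B i] consists of the vertices closest to [u i], in proportion to the number
    of its elements over [B i]. By the Cauchy-Schwarz inequality the covariance
    is at most the sum of [sqrt (al i * be i)], where [al i] and [be i] are the
    parts of the variances of [f1] and [f2] that fall to [B i]. For [i > 0] the
    automorphisms that fix the side of [u 0] carry the branch of [u i], which
    contains [B i], to [q ^ (i - 1)] disjoint places outside [B 0]
    ([branch_translates]), and the mass of [f1] is the same at all of them, so
    [q ^ (i - 1) * al i + al 0 <= var f1] ([branch_mass]). Symmetrically
    [q ^ (k - 1 - i) * be i + be k <= var f2] for [i < k]. In the sum each of the
    [k - 1] inner layers therefore contributes at most [q * q ^ (- k / 2)] times
    [sqrt (var f1 * var f2)], and the two end layers together at most once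
    more this amount ([layer_sum_bound]). *)

Set Implicit Arguments.
Unset Strict Implicit.
Unset Printing Implicit Defensive.

Import Order.TTheory GRing.Theory Num.Theory.
Import numFieldNormedType.Exports.

Local Open Scope classical_set_scope.

(** * Distances and sides of edges in a regular tree *)

Section Distance.
Context (V : choiceType) (e : rel V) (d : nat) (hT : is_regular_tree d e).
Implicit Types (a b v w x y z : V) (p : seq V).

Let e_sym : symmetric e. Proof. by case: hT => -[]. Qed.
Let e_irr : irreflexive e. Proof. by case: hT => -[]. Qed.

Lemma dist_ex x y :
  exists n, `[< exists p, [/\ path e x p, last x p = y & size p = n] >].
Proof.
case: hT => _ [conn _ _]; have [//|//|p xp lp] := conn x y.
by exists (size p); apply/asboolP; exists p.
Qed.

Definition dist x y : nat := ex_minn (dist_ex x y).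

Lemma dist_geodesic x y :
  exists p, [/\ path e x p, last x p = y & size p = dist x y].
Proof. by rewrite /dist; case: ex_minnP => n /asboolP. Qed.

Lemma dist_le_size x p : path e x p -> (dist x (last x p) <= size p)%N.
Proof.
move=> xp; rewrite /dist; case: ex_minnP => n _ -> //.
by apply/asboolP; exists p.
Qed.

Lemma graph_distE x y n : is_graph_dist e x y n -> n = dist x y.
Proof.
move=> [[p [xp lp sp]] hmin]; have [r [xr lr sr]] := dist_geodesic x y.
have := hmin r xr lr; have := dist_le_size xp; rewrite lp sp sr; lia.
Qed.

Lemma dist_is_graph_dist x y : is_graph_dist e x y (dist x y).
Proof.
split; first exact: dist_geodesic.
by move=> p xp <-; exact: dist_le_size.
Qed.

Lemma distxx x : dist x x = 0.
Proof. by have := @dist_le_size x [::] isT; rewrite leqn0 => /eqP. Qed.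

Lemma dist_eq0 x y : dist x y = 0 -> x = y.
Proof. by move=> h; have [[|z p] []] := dist_geodesic x y; rewrite h. Qed.

Lemma distC x y : dist x y = dist y x.
Proof.
suff le x' y' : (dist x' y' <= dist y' x')%N by apply/eqP; rewrite eqn_leq !le.
have [p [xp lp <-]] := dist_geodesic y' x'.
have rp : path e (last y' p) (rev (belast y' p)).
  by rewrite rev_path -(eq_path e_sym).
rewrite lp in rp.
have := dist_le_size rp; rewrite size_rev size_belast.
by case: p {xp rp} lp => [<-//|z p lp]; rewrite /= rev_cons last_rcons.
Qed.

Lemma dist_triangle y x z : (dist x z <= dist x y + dist y z)%N.
Proof.
have [p [xp lp <-]] := dist_geodesic x y.
have [r [yr lr <-]] := dist_geodesic y z.
rewrite -size_cat -lr -lp -last_cat; apply: dist_le_size.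
by rewrite cat_path xp lp.
Qed.

Lemma dist_edge x y : e x y -> dist x y = 1.
Proof.
move=> xy; have := @dist_le_size x [:: y]; rewrite /= xy => /(_ isT).
case E : (dist x y) => [|[|]]//; move: xy.
by rewrite (dist_eq0 E) e_irr.
Qed.

Lemma dist_step a x y : e x y -> (dist a y <= (dist a x).+1)%N.
Proof. by move=> /dist_edge xy; have := dist_triangle x a y; lia. Qed.

Lemma dist_pred a v n : dist a v = n.+1 -> exists2 z, e z v & dist a z = n.
Proof.
move=> av; have [p] := dist_geodesic a v; rewrite av.
case/lastP: p => [[]//|p y]; rewrite rcons_path last_rcons size_rcons.
move=> [/andP[ap py] yv [sp]]; rewrite {y}yv in py *.
exists (last a p) => //.
have := dist_le_size ap; have := dist_step a py; lia.
Qed.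

(** Two distinct vertices at the same distance from [a] are joined by following
    their geodesics back towards [a] until these meet. *)
Lemma layer_path a n x y : dist a x = n -> dist a y = n -> x != y ->
  exists p, [/\ path e x p, last x p = y, uniq (x :: p),
    {in x :: p, forall z, (dist a z <= n)%N} & (1 < size p)%N].
Proof.
elim: n x y => [|n IH] x y ax ay xy.
  by move: xy; rewrite -(dist_eq0 ax) -(dist_eq0 ay) eqxx.
have [x' x'x ax'] := dist_pred ax; have [y' y'y ay'] := dist_pred ay.
have [E|x'y'] := eqVneq x' y'.
  exists [:: x'; y]; rewrite -E in y'y.
  have x'Nx : x' != x by apply/eqP => F; move: x'x; rewrite F e_irr.
  have x'Ny : x' != y by apply/eqP => F; move: y'y; rewrite F e_irr.
  split => //=; first by rewrite e_sym x'x y'y.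
  - by rewrite !inE eq_sym negb_or x'Nx xy/= x'Ny.
  - by move=> z; rewrite !inE => /or3P[]/eqP->; lia.
have [p [pp lp up dp sp]] := IH _ _ ax' ay' x'y'.
exists (x' :: rcons p y); split.
- by rewrite /= rcons_path lp y'y e_sym x'x pp.
- by rewrite /= last_rcons.
- rewrite -rcons_cons cons_uniq rcons_uniq up andbT mem_rcons inE negb_or xy/=.
  by apply/andP; split; apply/negP => /dp; lia.
- move=> z; rewrite -rcons_cons inE mem_rcons inE.
  by move=> /or3P[/eqP->|/eqP->|/dp]; lia.
- by rewrite /= size_rcons; lia.
Qed.

(** An edge between vertices at the same distance from [a] would close the path of
    [layer_path] to a cycle. *)
Lemma dist_edge_neq a x y : e x y -> dist a x <> dist a y.
Proof.
move=> xy E; case: hT => _ [_ acyc _].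
have [F|xNy] := eqVneq x y; first by move: xy; rewrite F e_irr.
have [p [pp lp up _ sp]] := layer_path E (erefl _) xNy.
apply: (acyc (x :: p)) => //.
by rewrite /ucycle up /= rcons_path pp lp e_sym xy.
Qed.

(** Two parents of [v] would form a cycle with [v] and the path of [layer_path]
    that joins them. *)
Lemma parent_unique a n x y v : e x v -> e y v ->
  dist a x = n -> dist a y = n -> dist a v = n.+1 -> x = y.
Proof.
move=> xv yv ax ay av; apply/eqP; apply/negPn/negP => xNy.
case: hT => _ [_ acyc _].
have [p [pp lp up dp sp]] := layer_path ax ay xNy.
apply: (acyc (v :: x :: p)); first by move: sp => /=; lia.
rewrite /ucycle cons_uniq up andbT /= rcons_path pp lp yv e_sym xv/=.
by apply/negP => /dp; lia.
Qed.

Lemma dist_edge_cases a x y : e x y ->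
  dist a y = (dist a x).+1 \/ dist a x = (dist a y).+1.
Proof.
move=> xy; have := dist_edge_neq (a := a) xy; have := dist_step a xy.
by have := @dist_step a y x; rewrite e_sym => /(_ xy); lia.
Qed.

(** For an edge [a - b], the component of [b] after removal of that edge. *)
Definition side a b : set V := [set v | (dist b v < dist a v)%N].

Lemma sideN a b v : e a b -> ~ side a b v <-> side b a v.
Proof.
move=> ab; have := dist_edge_neq (a := v) ab.
by rewrite /side/= !(distC v); lia.
Qed.

(** Such an edge forces [dist a y = dist a x + 1 = dist b y + 1]. Unless [y] is
    [b], the parent of [y] seen from [a] is then both [x] and the next vertex on
    a geodesic from [y] to [b], although [x] is farther from [b] than [y]. *)
Lemma side_cross a b x y : e a b -> e x y -> ~ side a b x -> side a b y ->
  x = a /\ y = b.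
Proof.
move=> ab xy /(sideN _ ab) hx hy; rewrite /side/= in hx hy.
have := dist_step a xy; have yx : e y x by rewrite e_sym.
have h2 := dist_step b yx; move=> h1.
case n0 : (dist a x) => [|n].
  split; first by rewrite (dist_eq0 n0).
  have : dist b y = 0 by lia.
  by move/dist_eq0.
have [z zy bz] := @dist_pred b y n ltac:(lia).
have ba : e b a by rewrite e_sym.
have := dist_step z ab; have := dist_step z ba; rewrite !(distC z) => h3 h4.
have h5 := dist_step a zy.
have := @parent_unique a n.+1 z x y zy xy ltac:(lia) n0 ltac:(lia) => E.
by move: bz; rewrite E; lia.
Qed.

Lemma sideE a b v : side a b v = (dist b v < dist a v)%N :> Prop.
Proof. by []. Qed.

(** A walk that leaves the side of [a] traverses the edge [a - b]. *)
Lemma connected_side (H : subgraph e) a b : sg_connected H -> e a b ->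
  sg_vert H a -> ~ sg_vert H b -> sg_vert H `<=` side b a.
Proof.
move=> conn ab Ha Hb v Hv; apply/(sideN _ ab) => sv.
have [p ap lp] := conn a v Ha Hv.
have sa : ~ side a b a by rewrite /side/= distxx.
suff walk x : path (sg_edge H) x p -> last x p = v -> ~ side a b x -> False.
  exact: (walk a).
elim: p {ap lp} x => [|y p IH] x /=; first by move=> _ ->.
move=> /andP[xy yp] lp sx; apply: (IH y) => // sy.
have [_ E] := side_cross ab (sg_edge_sub xy) sx sy.
by have [_] := sg_edge_ends xy; rewrite E.
Qed.

End Distance.

(** * Vertices as words, and automorphisms that move a branch *)

Section Words.
Context (V : choiceType) (e : rel V) (d : nat) (hT : is_regular_tree d e).
Variable a : V.
Implicit Types (b v x y z : V) (w : seq nat).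

Local Notation dist := (dist hT).
Local Notation side := (side hT).

Let e_sym : symmetric e. Proof. by case: hT => -[]. Qed.
Let e_irr : irreflexive e. Proof. by case: hT => -[]. Qed.

Let regularP v : exists s : seq V, [/\ uniq s, size s = d & e v =i s].
Proof. by case: hT => _ [_ _]. Qed.

Definition children v : seq V :=
  [seq y <- sval (cid (regularP v)) | dist a y == (dist a v).+1].

Lemma mem_children v y :
  (y \in children v) = e v y && (dist a y == (dist a v).+1).
Proof.
rewrite mem_filter andbC; congr andb; case: cid => s /= [_ _ sE].
by rewrite -sE.
Qed.

Lemma children_uniq v : uniq (children v).
Proof. by apply: filter_uniq; case: cid => s /= []. Qed.

Lemma size_children v :
  size (children v) = if dist a v == 0 then d else d.-1.
Proof.
rewrite /children; case: cid => s /= [us sd sE]; rewrite size_filter.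
case E : (dist a v) => [|n] /=.
  rewrite -[RHS]sd; apply/eqP; rewrite -all_count; apply/allP => y; rewrite -sE => vy.
  by rewrite -(dist_eq0 E) in vy; rewrite (dist_edge hT vy).
have [z zv az] := dist_pred E.
have zs : z \in s by rewrite -sE /in_mem/= e_sym.
have := count_predC (fun y => dist a y == n.+2) s; rewrite sd.
rewrite [X in (_ + X = _)%N -> _](_ : _ = 1); first by lia.
have <- : count_mem z s = 1 by rewrite count_uniq_mem ?zs.
apply: eq_in_count => y; rewrite -sE => vy /=.
apply/idP/eqP => [h|->]; last by rewrite az; lia.
apply: (parent_unique _ zv _ az E); first by rewrite e_sym.
by have := dist_edge_cases hT a vy; lia.
Qed.

(** A word lists the choices of child made on the way down from the root [a];
    the root has one child more than the other vertices. *)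
Definition wf w : bool :=
  if w is j :: w' then (j < d)%N && all (fun i => i < d.-1)%N w' else true.

Definition vertex w : V := foldl (fun v j => nth v (children v) j) a w.

Lemma wf_rcons w j :
  wf (rcons w j) = wf w && (j < if size w == 0 then d else d.-1)%N.
Proof. by case: w => [|i w] /=; rewrite ?andbT// all_rcons; lia. Qed.

Lemma wf_take w n : wf w -> wf (take n w).
Proof.
case: w n => [|j w] [|n]//= /andP[-> wq] /=; apply/allP => i /mem_take.
exact: (allP wq).
Qed.

Lemma vertex_rcons w j :
  vertex (rcons w j) = nth (vertex w) (children (vertex w)) j.
Proof. by rewrite /vertex foldl_rcons. Qed.

Lemma dist_vertex w : wf w -> dist a (vertex w) = size w.
Proof.
elim/last_ind: w => [|w j IH]; first by rewrite distxx.
rewrite wf_rcons => /andP[/IH wE jlt]; rewrite size_rcons -wE.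
have : vertex (rcons w j) \in children (vertex w).
  by rewrite vertex_rcons mem_nth// size_children wE.
by rewrite mem_children => /andP[_ /eqP].
Qed.

Lemma vertex_child w j : wf (rcons w j) ->
  vertex (rcons w j) \in children (vertex w).
Proof.
rewrite wf_rcons => /andP[wfw jlt].
by rewrite vertex_rcons mem_nth// size_children dist_vertex.
Qed.

Lemma vertex_edge w j : wf (rcons w j) -> e (vertex w) (vertex (rcons w j)).
Proof. by move=> /vertex_child; rewrite mem_children => /andP[]. Qed.

Lemma vertex_inj w w' : wf w -> wf w' -> vertex w = vertex w' -> w = w'.
Proof.
elim/last_ind: w w' => [|w j IH] w' wfw wfw' E.
  apply/esym/nilP; rewrite /nilp -(dist_vertex wfw') -E distxx//.
case/lastP: w' => [|w' j'] in wfw' E *.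
  by have := dist_vertex wfw; rewrite E distxx size_rcons.
have := dist_vertex wfw; have := dist_vertex wfw'; rewrite E size_rcons => ->.
rewrite size_rcons => -[sE].
have := wfw; have := wfw'; rewrite !wf_rcons => /andP[w1' j1'] /andP[w1 j1].
have vv : vertex w = vertex w'.
  apply: (parent_unique (vertex_edge wfw) _ (dist_vertex w1)).
  - by rewrite E; exact: vertex_edge.
  - by rewrite dist_vertex.
  - by rewrite dist_vertex// size_rcons.
rewrite (IH _ w1 w1' vv) in j1 E *; congr rcons.
move: E; rewrite !vertex_rcons => /eqP; rewrite nth_uniq ?children_uniq//.
- by move/eqP.
- by rewrite size_children dist_vertex.
- by rewrite size_children dist_vertex.
Qed.

Lemma vertex_surj v : exists2 w, wf w & vertex w = v.
Proof.
elim: {v}(dist a v) {-2}v (erefl (dist a v)) => [|n IH] v av.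
  by exists [::] => //; rewrite -(dist_eq0 av).
have [z zv az] := dist_pred av; have [w wfw wz] := IH z az.
have vz : v \in children z by rewrite mem_children zv av az/=.
exists (rcons w (index v (children z))).
  rewrite wf_rcons wfw/= -(dist_vertex wfw) wz -size_children.
  by rewrite index_mem.
by rewrite vertex_rcons wz nth_index.
Qed.

Definition word v : seq nat := s2val (cid2 (vertex_surj v)).

Lemma wf_word v : wf (word v).
Proof. by rewrite /word; case: cid2. Qed.

Lemma wordK v : vertex (word v) = v.
Proof. by rewrite /word; case: cid2. Qed.

Lemma vertexK w : wf w -> word (vertex w) = w.
Proof. by move=> wfw; apply: vertex_inj => //; rewrite ?wordK ?wf_word. Qed.

Lemma size_word v : size (word v) = dist a v.
Proof. by rewrite -dist_vertex ?wf_word ?wordK. Qed.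

Lemma prefix_parent z v : e z v -> dist a v = (dist a z).+1 ->
  prefix (word z) (word v).
Proof.
move=> zv av; have := wf_word v; have := wordK v; have := size_word v.
case/lastP: (word v) => [|w j]; first by rewrite av.
rewrite size_rcons av => -[sw] vE wfv.
suff -> : word z = w by exact: prefix_rcons.
have wfw : wf w by move: wfv; rewrite wf_rcons => /andP[].
apply: vertex_inj => //; rewrite ?wf_word// wordK.
apply: (parent_unique zv _ (erefl _) _ av).
  by rewrite -vE vertex_edge.
by rewrite dist_vertex.
Qed.

Definition is_child w w' := (size w' == (size w).+1) && prefix w w'.

Lemma edge_words x y :
  e x y = is_child (word x) (word y) || is_child (word y) (word x).
Proof.
have child_edge x' y' : is_child (word x') (word y') -> e x' y'.
  move=> /andP[/eqP sE /prefixP[z zE]].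
  move: sE; rewrite zE size_cat -addn1 => /addnI.
  case: z zE => [|j []]// zE _; rewrite cats1 in zE.
  by have := wf_word y'; rewrite zE => /vertex_edge; rewrite -zE !wordK.
apply/idP/orP => [xy|[/child_edge//|/child_edge]]; last by rewrite e_sym.
by have [E|E] := dist_edge_cases hT a xy; [left|right];
  rewrite /is_child !size_word E eqxx/= prefix_parent// e_sym.
Qed.

(** The root [a] is not on the side of [y], so the way down to [v] has to cross the
    edge [x - y]. *)
Lemma prefix_word_side x y v : e x y -> dist a y = (dist a x).+1 ->
  side x y v -> prefix (word y) (word v).
Proof.
move=> xy axy.
elim: {v}(dist a v) {-2}v (erefl (dist a v)) => [|n IH] v av sv.
  by move: sv; rewrite sideE -(dist_eq0 av) !(distC hT _ a) axy ltnNge leqnSn.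
have [z zv az] := dist_pred av.
have zpv : prefix (word z) (word v) by rewrite prefix_parent// av az.
have [sz|sz] := pselect (side x y z).
  exact: prefix_trans (IH z az sz) zpv.
by have [_ ->] := side_cross xy zv sz sv; exact: prefix_refl.
Qed.

Lemma side_prefix b v : e a b -> prefix (word b) (word v) -> side a b v.
Proof.
move=> ab /prefixP[z zE]; rewrite sideE -size_word zE size_cat size_word.
rewrite (dist_edge hT ab) add1n ltnS -{1}(wordK v) zE.
have := wf_word v; rewrite zE; elim/last_ind: z {zE} => [|z j IH].
  by rewrite cats0 wordK distxx.
rewrite -rcons_cat => wfz; have := wfz; rewrite wf_rcons => /andP[/IH h _].
have := dist_step hT b (vertex_edge wfz); by rewrite size_rcons => /leq_trans; apply.
Qed.

(** Adjacency can be read off the words: one of them is the other without its last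
    letter. *)
Lemma word_aut (f g : seq nat -> seq nat) :
  (forall w, wf w -> wf (f w)) -> (forall w, wf w -> wf (g w)) ->
  (forall w, wf w -> g (f w) = w) -> (forall w, wf w -> f (g w) = w) ->
  (forall w, size (f w) = size w) ->
  (forall w n, take n (f w) = f (take n w)) ->
  exists h : graph_aut e, forall v, h v = vertex (f (word v)).
Proof.
move=> wff wfg fK gK sf ft.
have fK' : cancel (fun v => vertex (f (word v))) (fun v => vertex (g (word v))).
  by move=> v; rewrite vertexK ?fK ?wordK//; [exact: wf_word|exact/wff/wf_word].
have gK' : cancel (fun v => vertex (g (word v))) (fun v => vertex (f (word v))).
  by move=> v; rewrite vertexK ?gK ?wordK//; [exact: wf_word|exact/wfg/wf_word].
have fc w w' : wf w -> wf w' -> is_child (f w) (f w') = is_child w w'.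
  move=> wfw wfw'; rewrite /is_child !sf !prefixE sf ft; congr andb.
  apply/eqP/eqP => [E|-> //].
  by have := congr1 g E; rewrite !fK// wf_take.
have fe x y : e (vertex (f (word x))) (vertex (f (word y))) = e x y.
  by rewrite !edge_words !vertexK ?fc//; do ?apply: wff; exact: wf_word.
by exists (GraphAut fK' gK' fe).
Qed.

End Words.

Section Shift.
Variable q : nat.
Implicit Types (t w : seq nat).

Fixpoint shift t w : seq nat :=
  match t, w with
  | s :: t', j :: w' => ((j + s) %% q)%N :: shift t' w'
  | _, _ => w
  end.

Lemma size_shift t w : size (shift t w) = size w.
Proof. by elim: t w => [|s t IH] [|j w]//=; rewrite IH. Qed.

Lemma take_shift t w n : take n (shift t w) = shift t (take n w).
Proof. by elim: t w n => [|s t IH] [|j w] [|n]//=; rewrite IH. Qed.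

Lemma all_shift t w : (0 < q)%N -> all (fun i => i < q)%N w ->
  all (fun i => i < q)%N (shift t w).
Proof.
move=> q0; elim: t w => [|s t IH] [|j w]//= /andP[jq wq].
by rewrite ltn_mod q0 IH.
Qed.

Lemma shiftK t w : all (fun i => i < q)%N t -> all (fun i => i < q)%N w ->
  shift [seq (q - s)%N | s <- t] (shift t w) = w.
Proof.
elim: t w => [|s t IH] [|j w]//= /andP[sq tq] /andP[jq wq].
by rewrite IH// modnDml -addnA subnKC ?modnDr ?modn_small// ltnW.
Qed.

Lemma shiftKV t w : all (fun i => i < q)%N t -> all (fun i => i < q)%N w ->
  shift t (shift [seq (q - s)%N | s <- t] w) = w.
Proof.
elim: t w => [|s t IH] [|j w]//= /andP[sq tq] /andP[jq wq].
by rewrite IH// modnDml -addnA subnK ?modnDr ?modn_small// ltnW.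
Qed.

Lemma shift_cat t w w' : size w = size t -> shift t (w ++ w') = shift t w ++ w'.
Proof. by elim: t w => [|s t IH] [|j w]//= [sw]; rewrite IH. Qed.

Lemma shift_inj t t' w : size t = size w -> size t' = size w ->
  all (fun i => i < q)%N t -> all (fun i => i < q)%N t' ->
  shift t w = shift t' w -> t = t'.
Proof.
elim: t t' w => [|s t IH] [|s' t'] [|j w]//= [st] [st'].
move=> /andP[sq tq] /andP[sq' tq'] [/eqP + wE]; rewrite eqn_modDl.
by rewrite !modn_small// => /eqP ->; rewrite (IH t' w).
Qed.

(** The shift at each level is the same for all vertices of that level, so prefixes
    are respected; the branches at the other children of the root are fixed. *)
Definition shift_branch (c : nat) t w : seq nat :=
  if w is j :: w' then if j == c then j :: shift t w' else w else [::].

End Shift.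

(** In words rooted at [a], these automorphisms shift the [m] letters that lead
    from [b] down to [y], independently of each other; the words in the images of
    the branch at [y] then start with different prefixes. *)
Lemma branch_translates (V : choiceType) (e : rel V) (d : nat)
    (hT : is_regular_tree d e) (a b x y : V) (m : nat) :
  (2 <= d)%N -> e a b -> e x y -> dist hT a x = m -> dist hT a y = m.+1 ->
  dist hT b y = m ->
  exists g : m.-tuple 'I_d.-1 -> graph_aut e,
    [/\ forall t v, side hT b a v -> g t v = v,
        forall t v, side hT x y v -> side hT a b (g t v) &
        forall t t' v v', side hT x y v -> side hT x y v' -> g t v = g t' v' ->
          t = t'].
Proof.
move=> d2 ab xy ax ay bye; pose word := word hT a; pose vertex := vertex hT a.
have axy : dist hT a y = (dist hT a x).+1 by rewrite ax ay.
have aab : dist hT a b = (dist hT a a).+1 by rewrite distxx (dist_edge hT ab).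
have q0 : (0 < d.-1)%N by lia.
have [c wb] : exists c, word b = [:: c].
  have := size_word hT a b; rewrite (dist_edge hT ab) -/word.
  by case: (word b) => [|c []]// _; exists c.
have : prefix (word b) (word y).
  by apply: (prefix_word_side ab aab); rewrite sideE bye ay.
rewrite wb => /prefixP[p /= yE].
have sp : size p = m by have := size_word hT a y; rewrite -/word yE ay => -[].
pose tl (t : m.-tuple 'I_d.-1) : seq nat := map val t.
have tlq t : all (fun i => i < d.-1)%N (tl t).
  by apply/allP => i /mapP[j _ ->]; exact: ltn_ord.
have wfs t w : wf d w -> wf d (shift_branch d.-1 c t w).
  case: w => [//|j w] /= /andP[jd wq]; case: ifP => _ /=.
    by rewrite jd all_shift.
  by rewrite jd wq.
have /choice[g gE] (t : m.-tuple 'I_d.-1) : exists h : graph_aut e,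
    forall v, h v = vertex (shift_branch d.-1 c (tl t) (word v)).
  apply: (@word_aut _ _ _ _ _ _
    (shift_branch d.-1 c [seq (d.-1 - s)%N | s <- tl t])).
  + exact: wfs.
  + exact: wfs.
  + move=> [//|j w] /= /andP[jd wq]; case: ifP => [/eqP jc|jc] /=.
      by rewrite jc eqxx shiftK.
    by rewrite jc.
  + move=> [//|j w] /= /andP[jd wq]; case: ifP => [/eqP jc|jc] /=.
      by rewrite jc eqxx shiftKV.
    by rewrite jc.
  + by case=> [//|j w] /=; case: ifP => _ //=; rewrite size_shift.
  + case=> [|j w] [|n] //=; case: ifP => _ //=; by rewrite take_shift.
have sideE v : side hT x y v ->
    exists z, forall t, word (g t v) = c :: shift d.-1 (tl t) p ++ z.
  move=> /(prefix_word_side xy axy); rewrite -/word yE => /prefixP[z vE].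
  exists z => t; rewrite gE /word vertexK.
    by rewrite -/word vE /= eqxx shift_cat// size_map size_tuple.
  exact/wfs/wf_word.
exists g; split.
+ move=> t v /(sideN hT _ ab) sv; rewrite gE -[RHS](wordK hT a) -/word.
  congr vertex; case vE : (word v) => [//|j w] /=; case: eqP => // jc.
  case: sv; apply: side_prefix => //.
  by rewrite -/word wb vE jc /= eqxx prefix0s.
+ move=> t v /sideE[z vE]; apply: side_prefix => //.
  by rewrite -/word vE wb /= eqxx prefix0s.
+ move=> t t' v v' /sideE[z vE] /sideE[z' vE'] E.
  have := vE t; rewrite E vE' => -[] /(congr1 (take m)).
  rewrite !take_size_cat ?size_shift// => /esym tt'.
  apply: val_inj; apply: (inj_map val_inj).
  by apply: shift_inj (tlq t) (tlq t') tt'; rewrite size_map size_tuple.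
Qed.

Local Open Scope ring_scope.

(** * Elementary inequalities *)

Lemma discriminant_le0 (R : realFieldType) (a b c : R) : 0 <= a -> 0 <= b ->
  (forall x y, 0 <= x ^+ 2 * a + 2 * (x * y) * c + y ^+ 2 * b) ->
  c ^+ 2 <= a * b.
Proof.
move=> a0; rewrite le_eqVlt => /predU1P[b0|b0] key.
  (* Here the form is affine in [y]; these values make it [- c ^+ 2]. *)
  by have := key c (- (a + 1) / 2); rewrite -b0; nra.
have := key b (- c); rewrite (_ : _ + _ = b * (a * b - c ^+ 2)); last by ring.
by rewrite pmulr_rge0// subr_ge0.
Qed.

Section Real.
Variable R : rcfType.

Lemma weighted_cauchy_schwarz (I : Type) (s : seq I) (w a b : I -> R) :
  (forall i, 0 <= w i) ->
  \sum_(i <- s) w i * (a i * b i) <=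
  Num.sqrt ((\sum_(i <- s) w i * a i ^+ 2) * (\sum_(i <- s) w i * b i ^+ 2)).
Proof.
move=> w0; apply: le_trans (ler_norm _) _; rewrite -sqrtr_sqr ler_wsqrtr//.
have nn (h : I -> R) : 0 <= \sum_(i <- s) w i * h i ^+ 2.
  by apply: sumr_ge0 => i _; rewrite mulr_ge0// sqr_ge0.
apply: discriminant_le0 => // x y.
have := nn (fun i => x * a i + y * b i).
rewrite !mulr_sumr -!big_split/=; congr (0 <= _); apply: eq_bigr => i _; ring.
Qed.

(** This is the Cauchy-Schwarz inequality for the vectors [(sqrt x, sqrt (a - x))]
    and [(sqrt (b - y), sqrt y)], of squared lengths [a] and [b]. *)
Lemma cauchy_schwarz2 (x y a b : R) : 0 <= x <= a -> 0 <= y <= b ->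
  Num.sqrt (x * (b - y)) + Num.sqrt ((a - x) * y) <= Num.sqrt (a * b).
Proof.
move=> /andP[x0 xa] /andP[y0 yb].
have bx : 0 <= b - y by rewrite subr_ge0.
have ax : 0 <= a - x by rewrite subr_ge0.
rewrite -(@ler_pXn2r _ 2)// ?nnegrE ?addr_ge0 ?sqrtr_ge0//.
rewrite sqr_sqrtr; last by rewrite mulr_ge0//; [exact: le_trans xa|exact: le_trans yb].
rewrite !sqrtrM//.
have := sqr_sqrtr x0; have := sqr_sqrtr y0; have := sqr_sqrtr bx.
have := sqr_sqrtr ax.
move: (Num.sqrt _) (Num.sqrt _) (Num.sqrt _) (Num.sqrt _) => p r s t.
move=> p2 r2 s2 t2.
have := sqr_ge0 (t * s - p * r); nra.
Qed.

(** After multiplication by [sqrt q ^ k] each of the [k - 1] inner terms is at most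
    [q * sqrt (a * b)], and the two end terms together are at most
    [sqrt q * sqrt (a * b)] by [cauchy_schwarz2]. *)
Lemma layer_sum_bound (k : nat) (q a b : R) (al be : nat -> R) :
  (0 < k)%N -> 1 <= q -> (forall i, 0 <= al i) -> (forall i, 0 <= be i) ->
  (forall i, (i < k)%N -> q ^+ i * al i.+1 + al 0%N <= a) ->
  (forall i, (i < k)%N -> q ^+ (k.-1 - i) * be i + be k <= b) ->
  \sum_(i < k.+1) Num.sqrt (al i * be i) <=
  k%:R * q * (1 / Num.sqrt q) ^+ k * Num.sqrt (a * b).
Proof.
case: k => // k _ q1 al0 be0 ala beb.
have q0 : 0 < q by exact: lt_le_trans q1.
have qn n : 0 <= q ^+ n by rewrite exprn_ge0// ltW.
have s1 : 1 <= Num.sqrt q by rewrite -[leLHS]sqrtr1 ler_wsqrtr.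
have s0 : 0 < Num.sqrt q by rewrite sqrtr_gt0.
have sq n : Num.sqrt q ^+ n = Num.sqrt (q ^+ n).
  elim: n => [|n IH]; first by rewrite !expr0 sqrtr1.
  by rewrite !exprS IH sqrtrM// ltW.
have aA i : 0 <= q ^+ i * al i.+1 by rewrite mulr_ge0.
have bB i : 0 <= q ^+ (k - i) * be i by rewrite mulr_ge0.
have a0 : 0 <= a by have := ala 0%N isT; have := al0 0%N; have := aA 0%N; lra.
have b0 : 0 <= b by have := beb 0%N isT; have := be0 k.+1; have := bB 0%N; rewrite /=; lra.
set S := Num.sqrt (a * b); have S0 : 0 <= S by exact: sqrtr_ge0.
set G := Num.sqrt q ^+ k.+1; have G0 : 0 < G by exact: exprn_gt0.
have sqK : Num.sqrt q * Num.sqrt q = q by rewrite -expr2 sqr_sqrtr// ltW.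
have Gt i j : G * Num.sqrt (al i * be j) = Num.sqrt (q ^+ k.+1 * (al i * be j)).
  by rewrite /G sq -sqrtrM.
have mid (i : nat) : (i < k)%N -> G * Num.sqrt (al i.+1 * be i.+1) <= q * S.
  move=> ik; rewrite Gt; have -> : q ^+ k.+1 * (al i.+1 * be i.+1) =
      q ^+ 2 * ((q ^+ i * al i.+1) * (q ^+ (k - i.+1) * be i.+1)).
    have -> : k.+1 = (2 + (i + (k - i.+1)))%N by lia.
    by rewrite !exprD; ring.
  rewrite sqrtrM ?qn// sqrtr_sqr gtr0_norm// ler_pM2l//.
  rewrite ler_wsqrtr// ler_pM//.
    by have := ala i (ltnW ik); have := al0 0%N; lra.
  by have := beb i.+1 ik; have := be0 k.+1; rewrite /=; lra.
have ends : G * Num.sqrt (al 0%N * be 0%N) + G * Num.sqrt (al k.+1 * be k.+1) <=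
    q * S.
  apply: le_trans (_ : Num.sqrt q * S <= _); last first.
    by rewrite ler_wpM2r// -[leRHS]sqK ler_peMr// (ltW s0).
  have xa := ala k (ltnSn k); have yb := beb 0%N isT; rewrite /= subn0 in yb.
  have := @cauchy_schwarz2 (al 0%N) (be k.+1) a b.
  rewrite al0 be0 /= => /(_ _ _)/(fun h => ler_wpM2l (ltW s0) h) cs.
  apply: le_trans (cs _ _).
  - rewrite mulrDr !Gt; apply: lerD.
    + rewrite -sqrtrM ?(ltW q0)// ler_wsqrtr// exprS -!mulrA ler_pM2l//.
      by rewrite mulrCA ler_wpM2l// lerBrDr.
    + rewrite -sqrtrM ?(ltW q0)// ler_wsqrtr// exprS -!mulrA ler_pM2l//.
      by rewrite mulrA ler_wpM2r// lerBrDr.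
  - by have := aA k; lra.
  - by have := bB 0%N; rewrite subn0; lra.
have total : G * (\sum_(i < k.+2) Num.sqrt (al i * be i)) <= k.+1%:R * q * S.
  rewrite big_ord_recl big_ord_recr /= mulrDr mulrDr addrCA -natr1 mulrDl mul1r mulrDl.
  apply: lerD ends; rewrite mulr_sumr.
  apply: le_trans (_ : \sum_(i < k) q * S <= _).
    by apply: ler_sum => i _; rewrite mid.
  by rewrite sumr_const card_ord -[leLHS]mulr_natl mulrA.
rewrite div1r exprVn -/G [leRHS]mulrAC ler_pdivlMr// mulrC.
exact: total.
Qed.

End Real.

(** * Square-integrable functions and orthonormal families *)

Section InnerProduct.
Context (R : realType) (dT : measure_display) (T : measurableType dT).
Variable P : probability T R.
Implicit Types (f g h : T -> R) (c : R).

Local Notation L2 := (Lfun P 2%:E).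

Let twoge1 : (1 <= 2%:E :> \bar R)%E. Proof. by rewrite lee1n. Qed.

Lemma L2D f g : f \in L2 -> g \in L2 -> f + g \in L2.
Proof. by move=> ? ?; rewrite rpredD. Qed.

Lemma L2Z c f : f \in L2 -> c *: f \in L2.
Proof. by move=> ?; rewrite rpredZ. Qed.

Lemma L2B f g : f \in L2 -> g \in L2 -> f - g \in L2.
Proof. by move=> ? ?; rewrite -scaleN1r L2D// L2Z. Qed.

Lemma L2_cst c : cst c \in L2.
Proof. exact: Lfun_cst. Qed.

Lemma L2_sum (I : Type) (s : seq I) (F : I -> T -> R) :
  (forall i, F i \in L2) -> \sum_(i <- s) F i \in L2.
Proof.
move=> FL; elim: s => [|i s IH]; first by rewrite big_nil; exact: L2_cst.
by rewrite big_cons L2D.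
Qed.

Lemma L2_measurable f : f \in L2 -> measurable_fun setT f.
Proof. by move=> /andP[]; rewrite inE. Qed.

Lemma L2_Lfun1 f : f \in L2 -> f \in Lfun P 1.
Proof. by apply: Lfun_subset12; exact: fin_num_measure. Qed.

Lemma L2M f g : f \in L2 -> g \in L2 -> f * g \in Lfun P 1.
Proof. exact: Lfun2_mul_Lfun1. Qed.

Lemma integrable_sqr_L2 f : measurable_fun setT f ->
  (\int[P]_x ((f x) ^+ 2)%:E < +oo)%E -> f \in L2.
Proof.
move=> mf ioo; apply/andP; split; rewrite inE//=.
rewrite /finite_norm unlock; apply: poweR_lty; apply: le_lt_trans ioo.
apply: ge0_le_integral => //.
- by move=> x _ /=; rewrite lee_fin powR_ge0.
- apply/measurable_EFinP.
  apply/(@measurableT_comp _ _ _ _ _ _ (fun x : R => x `^ 2)) => //.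
  exact/measurableT_comp.
- by apply/measurable_EFinP; exact: measurable_funX.
- by move=> x _ /=; rewrite lee_fin powR_mulrn// real_normK// num_real.
Qed.

Definition inner f g : R := fine 'E_P[f * g].

Lemma innerC f g : inner f g = inner g f.
Proof. by rewrite /inner mulrC. Qed.

Lemma inner_ge0 f : 0 <= inner f f.
Proof. by apply/fine_ge0/expectation_ge0 => x; exact: sqr_ge0. Qed.

Lemma innerDl f g h : f \in L2 -> g \in L2 -> h \in L2 ->
  inner (f + g) h = inner f h + inner g h.
Proof.
move=> fL gL hL; rewrite /inner -fineD ?expectation_fin_num ?L2M//.
by rewrite mulrDl expectationD ?L2M.
Qed.

Lemma innerZl c f g : f \in L2 -> g \in L2 -> inner (c *: f) g = c * inner f g.
Proof.
move=> fL gL; rewrite /inner (_ : (c *: f) * g = c \o* (f * g)); last first.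
  by apply/funext => x; rewrite !fctE /= -mulrA mulrC.
by rewrite expectationZl ?L2M// fineM ?expectation_fin_num ?L2M.
Qed.

Lemma innerBl f g h : f \in L2 -> g \in L2 -> h \in L2 ->
  inner (f - g) h = inner f h - inner g h.
Proof.
move=> fL gL hL.
by rewrite -scaleN1r innerDl ?L2Z// innerZl// mulN1r.
Qed.

Lemma innerBr f g h : f \in L2 -> g \in L2 -> h \in L2 ->
  inner h (f - g) = inner h f - inner h g.
Proof. by move=> fL gL hL; rewrite !(innerC h) innerBl. Qed.

Lemma inner_sumr (I : Type) (s : seq I) (c : I -> R) (F : I -> T -> R) f :
  (forall i, F i \in L2) -> f \in L2 ->
  inner f (\sum_(i <- s) c i *: F i) = \sum_(i <- s) c i * inner f (F i).
Proof.
move=> FL fL; elim: s => [|i s IH].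
  rewrite !big_nil /inner mulr0 (_ : 0 = cst 0)//.
  by rewrite expectation_cst.
rewrite !big_cons innerC innerDl ?L2Z ?L2_sum// => [|j]; last by rewrite L2Z.
by rewrite innerZl// innerC; congr (_ + _); rewrite innerC.
Qed.

Lemma innerD_sqr f g : f \in L2 -> g \in L2 ->
  inner (f + g) (f + g) = inner f f + inner f g *+ 2 + inner g g.
Proof.
move=> fL gL; rewrite innerDl ?L2D// !(innerC _ (f + g)) !innerDl//.
by rewrite (innerC g f) mulr2n !addrA.
Qed.

Lemma cauchy_schwarz f g : f \in L2 -> g \in L2 ->
  `|inner f g| <= Num.sqrt (inner f f) * Num.sqrt (inner g g).
Proof.
move=> fL gL; rewrite -sqrtrM ?inner_ge0// -sqrtr_sqr ler_wsqrtr//.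
apply: discriminant_le0; rewrite ?inner_ge0// => a b.
have := inner_ge0 (a *: f + b *: g).
rewrite innerD_sqr ?L2Z// !innerZl ?L2Z// !(innerC _ (_ *: _)) !innerZl//.
by rewrite (innerC g f); congr (0 <= _); ring.
Qed.

Section Orthonormal.
Context (I : eqType) (phi : I -> T -> R).
Hypothesis phiL : forall i, phi i \in L2.
Hypothesis phi_on : forall i j, inner (phi i) (phi j) = (i == j)%:R.

Definition fourier_coef f i : R := inner f (phi i).

Definition proj (D : seq I) f : T -> R := \sum_(i <- D) fourier_coef f i *: phi i.

Let projL D f : proj D f \in L2.
Proof. by apply: L2_sum => i; exact: L2Z. Qed.

Lemma inner_proj_compl D f i : uniq D -> f \in L2 -> i \in D ->
  inner (f - proj D f) (phi i) = 0.
Proof.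
move=> uD fL iD; rewrite innerBl// (innerC (proj D f)) inner_sumr//.
rewrite (bigD1_seq i)//= phi_on eqxx mulr1 big1 ?addr0 ?subrr//.
by move=> j ji; rewrite phi_on eq_sym (negbTE ji) mulr0.
Qed.

Lemma bessel D f : uniq D -> f \in L2 ->
  \sum_(i <- D) fourier_coef f i ^+ 2 <= inner f f.
Proof.
move=> uD fL; have := inner_ge0 (f - proj D f).
rewrite innerBr ?L2B// inner_sumr ?L2B// big1_seq ?subr0; last first.
  by move=> i /andP[_ iD]; rewrite inner_proj_compl// mulr0.
by rewrite innerBl// (innerC (proj D f)) inner_sumr// subr_ge0.
Qed.

Definition linear_comb (s : seq (R * I)) : T -> R := \sum_(p <- s) p.1 *: phi p.2.

Lemma L2_lincomb s : linear_comb s \in L2.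
Proof. by apply: L2_sum => p; exact: L2Z. Qed.

Definition in_span f : Prop := forall eps : R, 0 < eps ->
  exists s, inner (f - linear_comb s) (f - linear_comb s) <= eps.

(** The orthogonal projection onto a span is the best approximation in it, so it
    suffices that the span of [D] contains a good approximation of [f]. *)
Lemma parseval f g : f \in L2 -> g \in L2 -> in_span f ->
  forall eps : R, 0 < eps -> exists2 D, uniq D &
    `|inner f g - \sum_(i <- D) fourier_coef f i * fourier_coef g i| <= eps.
Proof.
move=> fL gL fspan eps eps0.
have N0 : 0 < inner g g + 1 by rewrite ltr_wpDl ?inner_ge0.
have [s hs] := fspan _ (divr_gt0 (exprn_gt0 2 eps0) N0).
pose D := undup [seq p.2 | p <- s]; exists D; first exact: undup_uniq.
rewrite -inner_sumr// -/(proj D f) (innerC g) -innerBl//.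
have pf : inner (f - proj D f) (f - proj D f) <=
    inner (f - linear_comb s) (f - linear_comb s).
  have uL : f - proj D f \in L2 by exact: L2B.
  have uv : inner (f - proj D f) (proj D f - linear_comb s) = 0.
    rewrite innerBr ?L2_lincomb// !inner_sumr//.
    rewrite !big1_seq ?subr0// => [p|i] /andP[_ iD].
      rewrite inner_proj_compl ?mulr0 ?undup_uniq//.
      by rewrite mem_undup map_f.
    by rewrite inner_proj_compl ?mulr0 ?undup_uniq.
  have -> : f - linear_comb s = (f - proj D f) + (proj D f - linear_comb s).
    by rewrite addrA subrK.
  rewrite [leRHS]innerD_sqr ?L2B ?L2_lincomb// uv mul0rn addr0.
  by rewrite lerDl inner_ge0.
apply: le_trans (cauchy_schwarz _ _) _ => //; first exact: L2B.
rewrite -sqrtrM ?inner_ge0// -[leRHS]ger0_norm ?(ltW eps0)// -sqrtr_sqr.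
rewrite ler_sqrt ?sqr_ge0//.
apply: le_trans (_ : eps ^+ 2 / (inner g g + 1) * (inner g g + 1) <= _).
  apply: ler_pM; rewrite ?inner_ge0 ?lerDl//; exact: le_trans pf hs.
by rewrite divfK// gt_eqF.
Qed.

End Orthonormal.

End InnerProduct.

(** * Density of a multiplicative orthonormal family *)

Section Density.
Context (R : realType) (dT : measure_display) (T : measurableType dT).
Variable P : probability T R.
Implicit Types (f g h u v : T -> R) (A B : set T).

Local Notation L2 := (Lfun P 2%:E).
Local Notation ip := (inner P).

Lemma L2_dominated u v : measurable_fun setT u -> v \in L2 ->
  (forall x, `|u x| <= `|v x|) -> u \in L2.
Proof.
move=> mu vL uv; apply: integrable_sqr_L2 => //.
have /integrable_lty := Lfun2_integrable_sqr vL.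
move=> /(_ measurableT); apply: le_lt_trans.
apply: ge0_le_integral => //.
- by move=> x _; rewrite lee_fin sqr_ge0.
- by apply/measurable_EFinP; exact: measurable_funX.
- by apply/measurable_EFinP; apply: measurable_funX; exact: L2_measurable vL.
- move=> x _ /=; rewrite lee_fin -(real_normK (num_real (u x))).
  by rewrite -(real_normK (num_real (v x))) lerXn2r// ?nnegrE.
Qed.

Lemma L2_bounded c u : measurable_fun setT u -> (forall x, `|u x| <= c) ->
  u \in L2.
Proof.
move=> mu uc; apply: L2_dominated mu (L2_cst P c) _ => x.
exact: le_trans (uc x) (ler_norm _).
Qed.

Lemma le_inner u v : measurable_fun setT u -> v \in L2 ->
  (forall x, `|u x| <= `|v x|) -> ip u u <= ip v v.
Proof.
move=> mu vL uv; have uL := L2_dominated mu vL uv.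
apply: fine_le; rewrite ?expectation_fin_num ?L2M//.
have mv := L2_measurable vL.
apply: expectation_le.
- exact: measurable_funM.
- exact: measurable_funM.
- by move=> x; exact: sqr_ge0.
- by move=> x; exact: sqr_ge0.
- apply: aeW => x; rewrite -[(u * u) x]/(u x * u x) -[(v * v) x]/(v x * v x).
  rewrite -!expr2 -(real_normK (num_real (u x))).
  by rewrite -(real_normK (num_real (v x))) lerXn2r// ?nnegrE.
Qed.

Lemma inner_indic A : measurable A -> ip (\1_A) (\1_A) = fine (P A).
Proof.
move=> mA; rewrite /inner (_ : \1_A * \1_A = \1_A) ?expectation_indic//.
apply/funext => x; rewrite -[LHS]/(\1_A x * \1_A x) !indicE.
by case: (_ \in _); rewrite ?mulr1 ?mulr0.
Qed.

Lemma innerD_sqr_le u v : u \in L2 -> v \in L2 ->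
  ip (u + v) (u + v) <= 2 * ip u u + 2 * ip v v.
Proof.
move=> uL vL; have := inner_ge0 P (u + -1 *: v).
rewrite !innerD_sqr ?L2Z// innerZl ?L2Z// !(innerC _ _ (_ *: _)) !innerZl//.
by rewrite (innerC _ v u); lra.
Qed.

Variables (I : eqType) (phi : I -> T -> R).
Hypothesis phi_meas : forall i, measurable_fun setT (phi i).
Hypothesis phi_le1 : forall i x, `|phi i x| <= 1.
Hypothesis phi_one : exists i, phi i = cst 1.
Hypothesis phi_mul : forall i j, exists k, phi i * phi j = phi k.

Local Notation in_span := (in_span P phi).
Local Notation lincomb := (linear_comb phi).

Let phiL i : phi i \in L2.
Proof. exact: L2_bounded (phi_meas i) (phi_le1 i). Qed.

Let lincombL s : lincomb s \in L2.
Proof. exact: L2_lincomb. Qed.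

Lemma lincomb_bounded s : exists2 c, 0 < c & forall x, `|lincomb s x| <= c.
Proof.
elim: s => [|p s [c c0 sc]].
  by exists 1 => // x; rewrite /linear_comb big_nil normr0.
exists (`|p.1| + c) => [|x]; first by rewrite ltr_wpDl.
rewrite /linear_comb big_cons.
apply: le_trans (ler_normD _ _) _; apply: lerD; last exact: sc.
by rewrite normrM ler_piMr.
Qed.

Lemma lincombM s t : exists r, lincomb s * lincomb t = lincomb r.
Proof.
pose m i j := sval (cid (phi_mul i j)).
have mE i j : phi i * phi j = phi (m i j) by rewrite /m; case: cid.
exists [seq (p.1 * p'.1, m p.2 p'.2) | p <- s, p' <- t].
rewrite /linear_comb big_allpairs_dep mulr_suml; apply: eq_bigr => p _.
rewrite mulr_sumr; apply: eq_bigr => p' _; rewrite /= -mE.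
by apply/funext => x; rewrite !fctE/= mulrACA.
Qed.

Lemma in_span_approx f : f \in L2 ->
  (forall eps, 0 < eps -> exists g, [/\ g \in L2, in_span g &
     ip (f - g) (f - g) <= eps]) -> in_span f.
Proof.
move=> fL fg eps eps0.
have e4 : 0 < eps / 4 by rewrite divr_gt0.
have [g [gL gs gf]] := fg _ e4; have [s sg] := gs _ e4.
exists s; rewrite (_ : f - lincomb s = (f - g) + (g - lincomb s)).
  apply: le_trans (innerD_sqr_le _ _) _; rewrite ?L2B//; lra.
by rewrite addrA subrK.
Qed.

Lemma in_span_lincomb s : in_span (lincomb s).
Proof.
by move=> eps eps0; exists s; rewrite subrr /inner mulr0 expectation_cst ltW.
Qed.

Lemma in_span_phi i : in_span (phi i).
Proof.
by have := in_span_lincomb [:: (1, i)]; rewrite /linear_comb big_seq1 scale1r.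
Qed.

Lemma in_span_cst c : in_span (cst c).
Proof.
have [i phi1] := phi_one; have := in_span_lincomb [:: (c, i)].
rewrite /linear_comb big_seq1 phi1 (_ : _ *: _ = cst c)//.
by apply/funext => x; exact: mulr1.
Qed.

Lemma in_span_null f : f \in L2 -> ip f f = 0 -> in_span f.
Proof.
move=> fL f0; apply: in_span_approx => // eps eps0; exists (cst 0).
split; [exact: L2_cst|exact: in_span_cst|].
by rewrite (_ : f - cst 0 = f) ?f0 ?ltW//; exact: subr0.
Qed.

Lemma in_spanD f g : f \in L2 -> g \in L2 -> in_span f -> in_span g ->
  in_span (f + g).
Proof.
move=> fL gL fs gs eps eps0; have e4 : 0 < eps / 4 by rewrite divr_gt0.
have [s sf] := fs _ e4; have [t tg] := gs _ e4; exists (s ++ t).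
rewrite (_ : f + g - lincomb _ = (f - lincomb s) + (g - lincomb t)).
  apply: le_trans (innerD_sqr_le _ _) _; rewrite ?L2B//; lra.
by rewrite /linear_comb big_cat/= opprD addrACA.
Qed.

Lemma in_spanZ c f : f \in L2 -> in_span f -> in_span (c *: f).
Proof.
move=> fL fs eps eps0; have c2 : 0 < c ^+ 2 + 1 by rewrite ltr_wpDl ?sqr_ge0.
have [s sf] := fs _ (divr_gt0 eps0 c2).
exists [seq (c * p.1, p.2) | p <- s].
rewrite (_ : _ - _ = c *: (f - lincomb s)); last first.
  rewrite scalerBr; congr (_ - _); rewrite /linear_comb big_map scaler_sumr.
  by apply: eq_bigr => p _; rewrite scalerA.
rewrite innerZl ?L2Z ?L2B// innerC innerZl ?L2B// mulrA -expr2.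
apply: le_trans (_ : (c ^+ 2 + 1) * (eps / (c ^+ 2 + 1)) <= _).
  by apply: ler_pM; rewrite ?sqr_ge0 ?inner_ge0 ?lerDl.
by rewrite mulrC divfK// gt_eqF.
Qed.

Lemma in_span_sum (J : Type) (s : seq J) (F : J -> T -> R) :
  (forall j, F j \in L2) -> (forall j, in_span (F j)) ->
  in_span (\sum_(j <- s) F j).
Proof.
move=> FL Fs; elim: s => [|j s IH]; first by rewrite big_nil; exact: in_span_cst.
by rewrite big_cons; apply: in_spanD => //; exact: L2_sum.
Qed.

Lemma L2_indic A : measurable A -> \1_A \in L2.
Proof.
move=> mA; apply: (@L2_bounded 1); first exact: measurable_indic.
by move=> x; rewrite indicE; case: (_ \in _); rewrite ?normr1 ?normr0.
Qed.

(** The approximation of [\1_B] is chosen first; as it is bounded, the one of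
    [\1_A] can be chosen so close that the product of the two is close to
    [\1_A * \1_B]. *)
Lemma in_spanM_indic A B : measurable A -> measurable B ->
  in_span (\1_A) -> in_span (\1_B) -> in_span (\1_(A `&` B)).
Proof.
move=> mA mB sA sB eps eps0; have e4 : 0 < eps / 4 by rewrite divr_gt0.
have [t tB] := sB _ e4; have [c c0 tc] := lincomb_bounded t.
have [s As] := sA _ (divr_gt0 e4 (exprn_gt0 2 c0)).
have [r rE] := lincombM s t; exists r.
have iAL := L2_indic mA; have iBL := L2_indic mB.
have mul_bound u v k : u \in L2 -> v \in L2 -> (forall x, `|u x| <= k) ->
    u * v \in L2 /\ ip (u * v) (u * v) <= k ^+ 2 * ip v v.
  move=> uL vL uk; have kv : k *: v \in L2 by exact: L2Z.
  have muv : measurable_fun setT (u * v).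
    by apply: measurable_funM; [exact: L2_measurable uL|exact: L2_measurable vL].
  have uv x : `|(u * v) x| <= `|(k *: v) x|.
    rewrite !normrM ler_wpM2r//; exact: le_trans (uk x) (ler_norm _).
  split; first exact: L2_dominated muv kv uv.
  by have := le_inner muv kv uv; rewrite innerZl ?L2Z// innerC innerZl// mulrA -expr2.
have [] := @mul_bound (\1_A) (\1_B - lincomb t) 1 iAL (L2B iBL (lincombL t)).
  by move=> x; rewrite indicE; case: (_ \in _); rewrite ?normr1 ?normr0.
move=> L1 b1.
have [] := @mul_bound (lincomb t) (\1_A - lincomb s) c (lincombL t)
  (L2B iAL (lincombL s)) tc.
move=> L1' b2.
rewrite (_ : \1_(A `&` B) - lincomb r =
  \1_A * (\1_B - lincomb t) + lincomb t * (\1_A - lincomb s)); last first.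
  rewrite -rE indicI; apply/funext => x.
  rewrite -[LHS]/(\1_A x * \1_B x - lincomb s x * lincomb t x).
  rewrite -[RHS]/(\1_A x * (\1_B x - lincomb t x) +
    lincomb t x * (\1_A x - lincomb s x)).
  by ring.
apply: le_trans (innerD_sqr_le L1 L1') _.
have : c ^+ 2 * ip (\1_A - lincomb s) (\1_A - lincomb s) <= eps / 4.
  apply: le_trans (_ : c ^+ 2 * (eps / 4 / c ^+ 2) <= _).
    by rewrite ler_wpM2l ?sqr_ge0.
  by rewrite mulrC divfK// gt_eqF ?exprn_gt0.
lra.
Qed.

Definition approx_set : set (set T) := [set A | measurable A /\ in_span (\1_A)].

Lemma approx_set_null A : measurable A -> P A = 0%E -> approx_set A.
Proof.
move=> mA A0; split=> //; apply: in_span_null; first exact: L2_indic.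
by rewrite inner_indic// A0.
Qed.

(** Differences are linear combinations of indicator functions, and by continuity of
    the measure the indicator functions of an increasing sequence of sets converge
    in mean square. *)
Lemma approx_set_sigma_algebra : sigma_algebra setT approx_set.
Proof.
apply/sigma_algebraP => //; split.
- split=> //; rewrite indicT; exact: in_span_cst.
- move=> A B BA [mA sA] [mB sB]; split; first exact: measurableD.
  have -> : (\1_(A `\` B) : T -> R) = (\1_A : T -> R) + (-1) *: (\1_B : T -> R).
    apply/funext => x; rewrite scaleN1r -[RHS]/(\1_A x - \1_B x) !indicE in_setD.
    have [xA|xA] := boolP (x \in A); have [xB|xB] := boolP (x \in B);
      rewrite /= ?subrr ?subr0//.
    by move: xA; rewrite (mem_set (BA _ (set_mem xB))).
  by apply: in_spanD; rewrite ?L2Z ?L2_indic//; apply: in_spanZ; rewrite ?L2_indic.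
- move=> F ndF FA.
  have mF n : measurable (F n) by have [] := FA n.
  have mU : measurable (\bigcup_n F n) by exact: bigcupT_measurable.
  split=> //; apply: in_span_approx; first exact: L2_indic.
  move=> eps eps0.
  have : P \o F @ \oo --> (fine (P (\bigcup_n F n)))%:E.
    by rewrite fineK ?fin_num_measure//; exact: nondecreasing_cvg_mu.
  move=> /fine_cvgP[_ /cvgrPdist_le/(_ _ eps0)[n _ /(_ n (leqnn n))]] nP.
  exists (\1_(F n)); split; [exact: L2_indic|by have [] := FA n|].
  have sub : F n `<=` \bigcup_n F n by move=> x Fx; exists n.
  have -> : (\1_(\bigcup_n F n) : T -> R) - \1_(F n) =
      \1_(\bigcup_n F n `\` F n).
    apply/funext => x; rewrite -[LHS]/(\1_(\bigcup_n F n) x - \1_(F n) x).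
    rewrite !indicE in_setD.
    have [xA|xA] := boolP (x \in F n); have [xB|xB] := boolP (x \in \bigcup_n F n);
      rewrite /= ?subrr ?subr0//.
    by move: xB; rewrite (mem_set (sub _ (set_mem xA))).
  rewrite inner_indic; last exact: measurableD.
  rewrite measureD// ?(setIidr sub)//; last by rewrite ltey_eq fin_num_measure.
  rewrite fineB ?fin_num_measure//; exact: le_trans (ler_norm _) nP.
- move=> A B [mA sA] [mB sB]; split; first exact: measurableI.
  exact: in_spanM_indic.
Qed.

Import HBNNSimple.

Lemma in_span_nnsfun (f : {nnsfun T >-> R}) :
  (forall A, measurable A -> in_span (\1_A)) -> in_span f.
Proof.
move=> AllA.
have -> : (f : T -> R) =
    \sum_(y <- fset_set (range f)) y *: (\1_(f @^-1` [set y]) : T -> R).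
  apply/funext => x; rewrite fimfunE fsbig_finite/=; last exact: fimfunP.
  by rewrite fct_sumE.
apply: in_span_sum => y; first by rewrite L2Z// L2_indic.
by apply: in_spanZ; [exact: L2_indic|exact: AllA].
Qed.

(** Simple functions that increase to [f] converge to it in mean square, by
    dominated convergence with the bound [f ^+ 2]. *)
Lemma in_span_ge0 f : (forall A, measurable A -> in_span (\1_A)) ->
  f \in L2 -> (forall x, 0 <= f x) -> in_span f.
Proof.
move=> AllA fL f0; have mf := L2_measurable fL.
have mEf : measurable_fun setT (EFin \o f) by apply/measurable_EFinP.
have [g [ndg gf]] := approximation measurableT mEf (fun t _ => f0 t).
have gle n x : g n x <= f x.
  have := gf x Logic.I => /fine_cvgP[_ h].
  have cg : (fun n => g n x) @ \oo --> f x by exact: h.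
  rewrite -(cvg_lim _ cg)//; apply: nondecreasing_cvgn_le.
    by move=> i j ij; have /lefP := ndg _ _ ij; exact.
  by apply/cvg_ex; exists (f x).
have gL n : (g n : T -> R) \in L2.
  apply: L2_dominated fL _; first exact: measurable_funP.
  by move=> x; rewrite !ger0_norm//; exact: gle.
apply: in_span_approx => // eps eps0.
have [] := @dominated_convergence _ _ _ P setT measurableT
  (fun n x => ((f x - g n x) ^+ 2)%:E) (cst 0%E) (fun x => (f x ^+ 2)%:E).
- move=> n; apply/measurable_EFinP; apply: measurable_funX.
  by apply: measurable_funB => //; exact: measurable_funP.
- exact: measurable_cst.
- apply: aeW => x _.
  have := gf x Logic.I => /fine_cvgP[_ h].
  have cg : (fun n => g n x) @ \oo --> f x by exact: h.
  apply/fine_cvgP; split; first exact: nearW.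
  rewrite /comp/=.
  have -> : 0 = (f x - f x) ^+ 2 :> R by rewrite subrr expr0n.
  by rewrite expr2; apply: cvgM; apply: cvgB => //; exact: cvg_cst.
- exact: Lfun2_integrable_sqr.
- apply: aeW => x n _; rewrite /= lee_fin ger0_norm ?sqr_ge0//.
  rewrite lerXn2r ?nnegrE ?subr_ge0 ?gle// lerBlDr lerDl//.
move=> _ _; rewrite integral0 => /fine_cvgP[_ /cvgrPdist_le/(_ _ eps0)].
move=> [n _ /(_ n (leqnn n))]; rewrite /= sub0r normrN => nP.
exists (g n); split => //; first exact: in_span_nnsfun.
apply: le_trans nP; apply: le_trans (ler_norm _); rewrite /inner unlock le_eqVlt.
by apply/orP; left; apply/eqP; congr fine; apply: eq_integral => x _; rewrite expr2.
Qed.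

Lemma in_span_L2 f : (forall A, measurable A -> in_span (\1_A)) ->
  f \in L2 -> in_span f.
Proof.
move=> AllA fL; have mf := L2_measurable fL.
have pL : f^\+ \in L2.
  apply: L2_dominated fL _; first exact: measurable_funrpos.
  move=> x; rewrite ger0_norm ?funrpos_ge0// /funrpos.
  by rewrite ge_max ler_norm normr_ge0.
have nL : f^\- \in L2.
  apply: L2_dominated fL _; first exact: measurable_funrneg.
  move=> x; rewrite ger0_norm ?funrneg_ge0// /funrneg.
  by rewrite ge_max normr_ge0 -normrN ler_norm.
rewrite (_ : f = f^\+ + (-1) *: f^\-); last first.
  by rewrite scaleN1r; rewrite [LHS](esym (funrposBneg f)).
apply: in_spanD; rewrite ?L2Z//; first exact: in_span_ge0.
by apply: in_spanZ => //; exact: in_span_ge0.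
Qed.

End Density.

(** * Binary digits and Rademacher functions *)

Section Translation.
Variable R : realType.
Local Notation mu := (@lebesgue_measure R).
Local Notation RR := (measurableTypeR R).

Lemma measurable_translation (c : R) :
  measurable_fun setT (fun x : RR => x + c : RR).
Proof. exact: measurable_funD. Qed.

Lemma lebesgue_measure_translation (c : R) (A : set RR) : measurable A ->
  mu ((fun x : RR => x + c) @^-1` A) = mu A.
Proof.
move=> mA; rewrite -[LHS]/(pushforward mu (fun x : RR => x + c : RR) A).
have mc := measurable_translation c.
apply/esym/lebesgue_measure_unique => // _ [[a b]] _ <-.
rewrite /pushforward.
rewrite [RHS](_ : _ = mu `]a - c, b - c]).
  rewrite !lebesgue_measure_itv/= !lte_fin ltrD2r.
  by congr (if _ then _ else _); rewrite -EFinB; congr EFin; ring.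
congr mu; apply/seteqP; split => x /=; rewrite !in_itv/= ltrBlDr lerBrDr//.
Qed.

(** For [c < 1] the endpoint 1 is moved like 0, which has the same binary digits. *)
Definition rotate (c x : R) : R := if x + c < 1 then x + c else x + c - 1.

Lemma measurable_rotate c : measurable_fun setT (rotate c : RR -> RR).
Proof.
apply: measurable_fun_ifT; last 2 first.
- exact: measurable_translation.
- by apply: measurable_funB => //; exact: measurable_translation.
- by apply: measurable_fun_ltr => //; exact: measurable_translation.
Qed.

Lemma uniform_probE (A : set RR) : measurable A ->
  uniform_prob (@ltr01 R) A = mu (A `&` `[0, 1[).
Proof.
move=> mA; rewrite /uniform_prob integral_uniform_pdf.
rewrite (eq_integral (cst 1%E)); last first.
  move=> x; rewrite inE/= in_itv/= => -[_ x01].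
  by rewrite /uniform_pdf x01 subr0 invr1.
rewrite integral_cst ?mul1e; last by apply: measurableI.
have -> : A `&` `[0, 1] = (A `&` `[0, 1[) `|` (A `&` [set 1]).
  by rewrite -setIUr setUitv1//= bnd_simp.
have m1 : measurable (A `&` [set 1 : RR]) by exact: measurableI.
rewrite measureU//.
- rewrite [X in (_ + X)%E](_ : _ = 0%E) ?adde0//.
  apply: (@subset_measure0 _ _ _ mu _ [set 1]) => //.
  exact: lebesgue_measure_set1.
- by apply: measurableI.
- by apply/seteqP; split => x //= [[_ /=]]; rewrite in_itv/= => + [_ E]; rewrite E ltxx andbF.
Qed.

(** The rotation translates [[0, 1 - c[] onto [[c, 1[] and [[1 - c, 1[] onto
    [[0, c[]. *)
Lemma uniform_prob_rotate c (A : set RR) : 0 <= c <= 1 -> measurable A ->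
  uniform_prob (@ltr01 R) (rotate c @^-1` A) = uniform_prob (@ltr01 R) A.
Proof.
move=> /andP[c0 c1] mA.
have mrA : measurable (rotate c @^-1` A : set RR).
  by rewrite -[_ @^-1` _]setTI; exact: measurable_rotate.
rewrite !uniform_probE//.
have mI (a b : R) : measurable (A `&` `[a, b[ : set RR) by exact: measurableI.
have -> : A `&` `[0, 1[ = (A `&` `[c, 1[) `|` (A `&` `[0, c[).
  rewrite -setIUr setUC; congr (_ `&` _).
  by apply/seteqP; split => x /=; rewrite !in_itv/=; lra.
have -> : rotate c @^-1` A `&` `[0, 1[ =
    ((fun x : RR => x + c) @^-1` (A `&` `[c, 1[)) `|`
    ((fun x : RR => x + (c - 1)) @^-1` (A `&` `[0, c[)).
  apply/seteqP; split => x /=; rewrite !in_itv/= /rotate addrA.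
    by case: ifP => xc [Ax x01]; [left|right]; split=> //; lra.
  move=> [[Ax x01]|[Ax x01]].
    by split; [rewrite ifT//; lra|lra].
  by split; [rewrite ifF//; lra|lra].
rewrite !measureU//.
- by congr (_ + _)%E; exact: lebesgue_measure_translation.
- by apply/seteqP; split => x //=; rewrite !in_itv/=; lra.
- by rewrite -[_ @^-1` _]setTI; exact: measurable_translation.
- by rewrite -[_ @^-1` _]setTI; exact: measurable_translation.
- by apply/seteqP; split => x //=; rewrite !in_itv/=; lra.
Qed.

End Translation.

Section Digits.
Variable R : realType.
Local Notation I01 := (I01 R).
Local Notation RR := (measurableTypeR R).
Local Notation val01 := (@unit_itv_val R).
Implicit Types (x : I01) (i j m n : nat).

Lemma val01P x : 0 <= val01 x <= 1.
Proof. by case: x. Qed.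

Definition digits m x : nat := Num.truncn (2 ^+ m * val01 x).

Lemma digits_eq m n x : (digits m x == n) = (n%:R <= 2 ^+ m * val01 x < n.+1%:R).
Proof.
by rewrite truncn_eq// mulr_ge0 ?exprn_ge0//; have /andP[] := val01P x.
Qed.

Lemma measurable_digits m n : measurable [set x | digits m x = n].
Proof.
exists [set` `[n%:R / 2 ^+ m, n.+1%:R / 2 ^+ m[]; first exact: measurable_itv.
rewrite setTI; apply/seteqP; split => x /=.
  rewrite in_itv/= ler_pdivrMr ?exprn_gt0// ltr_pdivlMr ?exprn_gt0//.
  by move=> h; apply/eqP; rewrite digits_eq mulrC.
move=> /eqP; rewrite digits_eq mulrC in_itv/=.
by rewrite ler_pdivrMr ?exprn_gt0// ltr_pdivlMr ?exprn_gt0.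
Qed.

Lemma digits_half m x : digits m x = (digits m.+1 x)./2.
Proof.
apply/eqP; rewrite digits_eq.
have := eqxx (digits m.+1 x); rewrite digits_eq exprS.
set N := digits _ _; have {1 2}-> : N = (odd N + N./2.*2)%N by rewrite odd_double_half.
rewrite -muln2 -addSn !natrD !natrM -!natr1; case: (odd N) => /=; lra.
Qed.

Definition rademacher j x : R := if odd (digits j.+1 x) then -1 else 1.

Lemma rademacher_sqr j x : rademacher j x * rademacher j x = 1.
Proof. by rewrite /rademacher; case: ifP => _; rewrite ?mulrNN mulr1. Qed.

Lemma norm_rademacher j x : `|rademacher j x| = 1.
Proof. by rewrite /rademacher; case: ifP => _; rewrite ?normrN normr1. Qed.

Lemma measurable_odd_digits m : measurable [set x | odd (digits m x)].
Proof.
have -> : [set x | odd (digits m x)] =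
    \bigcup_n [set x | digits m x = n.*2.+1].
  apply/seteqP; split => x /=.
    move=> oN; exists (digits m x)./2 => //=.
    by rewrite -[LHS]odd_double_half oN.
  by move=> [n _ /= ->]; rewrite /= odd_double.
by apply: bigcupT_measurable => n; exact: measurable_digits.
Qed.

Lemma rademacherE j x : rademacher j x = 1 - 2 * \1_[set x | odd (digits j.+1 x)] x.
Proof.
rewrite /rademacher indicE; have [od|od] := boolP (odd _); first by rewrite mem_set//=; ring.
by rewrite memNset/= ?mulr0 ?subr0//; exact/negP.
Qed.

Lemma measurable_rademacher j : measurable_fun setT (rademacher j : I01 -> R).
Proof.
rewrite (_ : rademacher j = fun x => 1 - 2 * \1_[set x | odd (digits j.+1 x)] x); last first.
  by apply/funext => x; rewrite rademacherE.
apply: measurable_funB => //; apply: measurable_funM => //.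
by apply: measurable_indic; exact: measurable_odd_digits.
Qed.

Lemma rotate01 c x : 0 <= c <= 1 -> 0 <= rotate c (val01 x) <= 1.
Proof. by have := val01P x; rewrite /rotate; case: ifP; lra. Qed.

Lemma step_in01 j : 0 <= (2 ^- j.+1 : R) <= 1.
Proof.
by rewrite invr_ge0 exprn_ge0//= invf_le1 ?exprn_gt0// exprn_ege1// ler1n.
Qed.

(** The binary digits of [x] before the [j]-th one may change too, through the
    carry; the later ones do not. *)
Definition flip_digit j x : I01 :=
  exist (fun y : R => 0 <= y <= 1) _ (rotate01 x (step_in01 j)).

Lemma measurable_flip_digit j : measurable_fun setT (flip_digit j).
Proof.
move=> _ _ [B mB <-]; exists (rotate (2 ^- j.+1) @^-1` B); last by rewrite !setTI.
by rewrite -[_ @^-1` _]setTI; exact: measurable_rotate.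
Qed.

Lemma digits_flip i j x : (j <= i)%N -> exists b : bool,
  (digits i.+1 (flip_digit j x) + b * 2 ^ i.+1 = digits i.+1 x + 2 ^ (i - j))%N.
Proof.
move=> ji; have [x0 _] := andP (val01P x).
exists (1 <= val01 x + 2 ^- j.+1).
have [y0 _] := andP (val01P (flip_digit j x)).
rewrite /digits addnC -[X in (X + _)%N](natrK (R := R)) -truncnD; last 2 first.
- exact: natr_nat.
- by rewrite nnegrE mulr_ge0 ?exprn_ge0.
rewrite addnC -[X in (X + _)%N](natrK (R := R)) -truncnD; last 2 first.
- exact: natr_nat.
- by rewrite nnegrE mulr_ge0 ?exprn_ge0.
congr Num.truncn; rewrite natrM !natrX /=.
have -> : 2 ^+ (i - j) = 2 ^+ i.+1 * 2 ^- j.+1 :> R.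
  by rewrite -subSS exprB// ?unitfE// pnatr_eq0.
rewrite /unit_itv_val /= -/(val01 x) /rotate; case: ltP => _ /=; ring.
Qed.

Lemma rademacher_flip_same j x : rademacher j (flip_digit j x) = - rademacher j x.
Proof.
have [b /(congr1 odd)] := digits_flip x (leqnn j).
rewrite subnn !oddD oddM oddX/= andbF addbF /rademacher => ->.
by case: (odd _); rewrite ?opprK.
Qed.

Lemma rademacher_flip_later i j x : (j < i)%N -> rademacher i (flip_digit j x) = rademacher i x.
Proof.
move=> ji; have [b /(congr1 odd)] := digits_flip x (ltnW ji).
rewrite !oddD oddM !oddX/= andbF addbF subn_eq0 leqNgt ji /= addbF.
by rewrite /rademacher => ->.
Qed.

End Digits.

(** * Measure-preserving maps and Walsh functions of an i.i.d. field *)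

Section MeasurePreserving.
Context (R : realType) (dT dT' : measure_display) (T : measurableType dT)
  (T' : measurableType dT').
Variable (P : probability T R) (P' : probability T' R) (tau : T -> T').
Hypothesis mtau : measurable_fun setT tau.
Hypothesis tauP : forall A, measurable A -> P (tau @^-1` A) = P' A.

Let ge0_integral_preserving (F : T' -> \bar R) : measurable_fun setT F ->
  (forall x, 0 <= F x)%E -> (\int[P]_x F (tau x) = \int[P']_x F x)%E.
Proof.
move=> mF F0.
transitivity (\int[pushforward P tau]_x F x)%E.
  by rewrite ge0_integral_pushforward// => x _; exact: F0.
by apply: eq_measure_integral => A mA _; exact: tauP.
Qed.

Lemma expectation_preserving (F : T' -> R) : measurable_fun setT F ->
  ('E_P[F \o tau] = 'E_P'[F])%E.
Proof.
move=> mF; have mE : measurable_fun setT (EFin \o F) by exact/measurable_EFinP.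
rewrite unlock integralE [RHS]integralE; congr (_ - _)%E.
- rewrite -[RHS](ge0_integral_preserving (measurable_funepos mE))//.
  by apply: eq_integral => x _; rewrite !funeposE.
- rewrite -[RHS](ge0_integral_preserving (measurable_funeneg mE))//.
  by apply: eq_integral => x _; rewrite !funenegE.
Qed.

Lemma inner_preserving (F G : T' -> R) : measurable_fun setT F ->
  measurable_fun setT G -> inner P (F \o tau) (G \o tau) = inner P' F G.
Proof.
move=> mF mG; congr fine.
rewrite -[RHS]expectation_preserving//; exact: measurable_funM.
Qed.

End MeasurePreserving.

Section Coordinates.
Context (I : Type) (dM : measure_display) (M : measurableType dM).

Lemma measurable_coord (i : I) :
  measurable_fun setT (fun w : product_space I M => w i).
Proof.
move=> _ B mB; rewrite setTI; apply: sub_sigma_algebra.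
by exists i => //; exists B => //; rewrite setTI.
Qed.

Lemma measurable_to_product dT (T : measurableType dT)
    (f : T -> product_space I M) :
  (forall i, measurable_fun setT (fun t => f t i)) -> measurable_fun setT f.
Proof.
move=> mf; refine (@measurability _ _ T (product_space I M) setT f (@cylinders I dM M) _ _) => //.
move=> _ [_ [i _ [B mB <-]] <-].
by rewrite !setTI; have := mf i measurableT B mB; rewrite setTI.
Qed.

End Coordinates.

Lemma measurable_coord_restrict (V : Type) (A : set V) dM (M : measurableType dM) :
  measurable_fun setT (@coord_restrict V A dM M).
Proof. by apply: measurable_to_product => i; exact: measurable_coord. Qed.

Section Walsh.
Context (R : realType) (V : choiceType).
Local Notation I01 := (I01 R).
Local Notation W := (product_space V I01).
Implicit Types (s : seq V) (B : V -> set I01) (S T : {fset V * nat}) (w : W).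

Definition box s B : set W :=
  \bigcap_(i in [set` s]) (fun w => w i) @^-1` B i.

Variables (mu : probability W R) (nu : probability I01 R).
Hypothesis mu_box : forall s B, uniq s ->
  (forall i, i \in s -> measurable (B i)) ->
  mu (box s B) = (\prod_(i <- s) nu (B i))%E.
Hypothesis nu_unif : forall B : set R, measurable B ->
  nu (@unit_itv_val R @^-1` B) = uniform_prob (@ltr01 R) B.

Let boxes : set (set W) := [set A | exists s B,
  [/\ uniq s, forall i, measurable (B i) & A = box s B]].

Lemma measurable_box s B : (forall i, measurable (B i)) -> measurable (box s B).
Proof.
move=> mB; apply: fin_bigcap_measurable; first exact: finite_seq.
by move=> i _; rewrite -[_ @^-1` _]setTI; exact: measurable_coord.
Qed.

Let boxes_gen : measurable = <<s boxes >>.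
Proof.
apply/seteqP; split.
  apply: smallest_sub; first exact: smallest_sigma_algebra.
  move=> A [i _ [B mB <-]]; apply: sub_sigma_algebra.
  exists [:: i], (fun=> B); split => //.
  rewrite setTI /box; apply/seteqP; split => w /=; first by move=> h j; rewrite /= inE => /eqP ->.
  by apply; rewrite /= inE.
apply: smallest_sub; first exact: sigma_algebra_measurable.
by move=> _ [s [B [_ mB ->]]]; exact: measurable_box.
Qed.

Let boxesI : setI_closed boxes.
Proof.
move=> _ _ [s [B [us mB ->]]] [s' [B' [us' mB' ->]]].
exists (undup (s ++ s')), (fun i => (if i \in s then B i else setT) `&`
  (if i \in s' then B' i else setT)); split; first exact: undup_uniq.
  by move=> i; apply: measurableI; case: ifP.
apply/seteqP; split => w.
  by move=> [h h'] i _ /=; split; case: ifP => //; [exact: h|exact: h'].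
move=> h; split => i /= si.
  have /h[] : i \in undup (s ++ s') by rewrite mem_undup mem_cat si.
  by rewrite si.
have /h[_] : i \in undup (s ++ s') by rewrite mem_undup mem_cat si orbT.
by rewrite si.
Qed.

Section Transform.
Variables (psi : V -> I01 -> I01) (sigma sigma' : V -> V).
Hypothesis psi_meas : forall v, measurable_fun setT (psi v).
Hypothesis psi_nu : forall v (C : set I01), measurable C ->
  nu (psi v @^-1` C) = nu C.
Hypothesis sigmaK : cancel sigma sigma'.

Definition transform w : W := fun v => psi v (w (sigma v)).

Lemma measurable_transform : measurable_fun setT transform.
Proof.
apply: measurable_to_product => v.
by apply: (measurableT_comp (psi_meas v)); exact: measurable_coord.
Qed.

(** The law of an independent family is determined by the measures of boxes, and a
    box is pulled back to a box of the same measure. *)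
Lemma transform_preserving A : measurable A -> mu (transform @^-1` A) = mu A.
Proof.
move=> mA; have mt := measurable_transform.
apply: (measure_unique boxes (fun=> setT) boxes_gen boxesI _ _
  (pushforward mu transform) mu) => //.
- move=> _; exists [::], (fun=> setT); split => //.
  by apply/seteqP; split.
- by apply/seteqP; split => // w _; exists 0%N.
- move=> _ [s [B [us mB ->]]].
  pose B' i := psi (sigma' i) @^-1` B (sigma' i).
  transitivity (mu (box (map sigma s) B')).
    rewrite /pushforward; congr (mu _); apply/seteqP; split => w h i /=.
      move=> /mapP[j js ->]; rewrite /B' /= sigmaK; exact: h.
    by move=> si; have := h (sigma i) (map_f _ si); rewrite /B' /= sigmaK.
  rewrite mu_box//.
  + rewrite big_map [RHS]mu_box//; apply: eq_bigr => i _.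
    by rewrite /B' sigmaK psi_nu.
  + by rewrite map_inj_uniq//; exact: can_inj sigmaK.
  + by move=> i _; rewrite /B' -[_ @^-1` _]setTI; exact: psi_meas.
- by move=> _; rewrite /= /pushforward preimage_setT probability_setT ltry.
Qed.

End Transform.

Lemma aut_act_preserving (e : rel V) (g : graph_aut e) (A : set W) :
  measurable A -> mu (aut_act g @^-1` A) = mu A.
Proof.
move=> mA; apply: (@transform_preserving (fun _ => id) (aut_inv g) g) => //.
exact: aut_invK.
Qed.

Lemma measurable_aut_act (e : rel V) (g : graph_aut e) :
  measurable_fun setT (aut_act g : W -> W).
Proof. by apply: measurable_to_product => v; exact: measurable_coord. Qed.

Definition walsh T w : R := \prod_(p <- T) rademacher p.2 (w p.1).

Lemma norm_walsh T w : `|walsh T w| = 1.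
Proof. by rewrite normr_prod big1// => p _; exact: norm_rademacher. Qed.

Lemma measurable_walsh T : measurable_fun setT (walsh T).
Proof.
apply: measurable_prod => p _.
exact: (measurableT_comp (measurable_rademacher p.2) (measurable_coord p.1)).
Qed.

Lemma walsh0 : walsh fset0 = cst 1.
Proof. by apply/funext => w; rewrite /walsh big_seq_fset0. Qed.

Definition symdiff S T : {fset V * nat} :=
  [fset p in (S `|` T)%fset | (p \in S) (+) (p \in T)]%fset.

(** Factors over common elements cancel, since Rademacher functions square to 1. *)
Lemma walsh_mul S T : walsh S * walsh T = walsh (symdiff S T).
Proof.
apply/funext => w; rewrite -[LHS]/(walsh S w * walsh T w) /walsh.
have restr (U : {fset V * nat}) : (U `<=` S `|` T)%fset ->
    \prod_(p <- U) rademacher p.2 (w p.1) =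
    \prod_(p <- (S `|` T)%fset) if p \in U then rademacher p.2 (w p.1) else 1.
  move=> US; rewrite -[RHS]big_mkcond [RHS]big_fset_condE/=; apply: eq_fbigl => p.
  by rewrite !inE; case: (boolP (p \in U)) => [/(fsubsetP US)|_];
    rewrite ?andbF// !inE => ->.
rewrite !restr ?fsubsetUl ?fsubsetUr//; last exact: fset_sub.
rewrite -big_split/=; apply: eq_fbigr => p pU _.
rewrite !inE -in_fsetU pU/=.
by case: (p \in S); case: (p \in T) => /=; rewrite ?mul1r ?mulr1// rademacher_sqr.
Qed.

Lemma nu_flip_digit j (B : set I01) : measurable B -> nu (flip_digit j @^-1` B) = nu B.
Proof.
move=> [C mC <-]; rewrite !setTI.
have -> : flip_digit j @^-1` (@unit_itv_val R @^-1` C) =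
  @unit_itv_val R @^-1` (rotate (2 ^- j.+1) @^-1` C) by [].
rewrite !nu_unif ?uniform_prob_rotate// ?step_in01//.
by rewrite -[_ @^-1` _]setTI; exact: measurable_rotate.
Qed.

(** Let [j] be minimal with [(v, j)] in [T]. Flipping the [j]-th digit at [v] by a
    rotation preserves the measure, and it changes the sign of the Walsh function:
    the other digits at [v] that occur in [T] come later and are unchanged. *)
Lemma walsh_mean0 T : T != fset0 -> ('E_mu[walsh T] = 0)%E.
Proof.
case/fset0Pn => -[v j0] vj0.
have ex : exists j, (v, j) \in T by exists j0.
case: (ex_minnP ex) => j vj jmin.
pose psi u := if u == v then @flip_digit R j else id.
have mpsi u : measurable_fun setT (psi u).
  by rewrite /psi; case: ifP => _ //; exact: measurable_flip_digit.
have npsi u (C : set I01) : measurable C -> nu (psi u @^-1` C) = nu C.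
  by move=> mC; rewrite /psi; case: ifP => _ //; exact: nu_flip_digit.
have sgn : walsh T \o transform psi id = -1 *: walsh T.
  apply/funext => w; rewrite -[LHS]/(walsh T (transform psi id w)).
  rewrite -[RHS]/(-1 * walsh T w) mulN1r /walsh !(big_fsetD1 _ vj)/= -mulNr.
  congr (_ * _); first by rewrite /transform /psi eqxx rademacher_flip_same.
  apply: eq_fbigr => -[u i]; rewrite !inE xpair_eqE => /andP[uvij uiT] _ /=.
  rewrite /transform /psi; case: eqP => // uv; subst u.
  rewrite eqxx/= in uvij; rewrite rademacher_flip_later//.
  by rewrite ltn_neqAle eq_sym uvij jmin.
have wL : walsh T \in Lfun mu 1.
  apply: L2_Lfun1; apply: (@L2_bounded _ _ _ _ 1); first exact: measurable_walsh.
  by move=> w; rewrite norm_walsh.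
have := expectation_preserving (measurable_transform id mpsi)
  (transform_preserving (sigma' := id) mpsi npsi (fun _ => erefl)) (measurable_walsh T).
rewrite sgn (_ : -1 *: walsh T = -1 \o* walsh T); last first.
  by apply/funext => w; exact: mulrC.
rewrite expectationZl//.
have := expectation_fin_num wL; case: ('E_mu[walsh T])%E => // r _ [].
by move=> /eqP; rewrite mulN1r eq_sym -subr_eq0 opprK -mulr2n mulrn_eq0/= => /eqP ->.
Qed.

Lemma walsh_orthonormal S T : inner mu (walsh S) (walsh T) = (S == T)%:R.
Proof.
rewrite /inner walsh_mul; case: eqP => [->|ST].
  rewrite (_ : symdiff T T = fset0) ?walsh0 ?expectation_cst//.
  by apply/fsetP => p; rewrite !inE addbb andbF.
rewrite walsh_mean0//; apply/eqP => E; apply: ST; apply/fsetP => p.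
have := in_fset0 p; rewrite -E !inE.
by case: (p \in S); case: (p \in T).
Qed.

Local Notation approx := (approx_set mu walsh).

Let walsh_le1 T w : `|walsh T w| <= 1.
Proof. by rewrite norm_walsh. Qed.

Let walsh_one : exists T, walsh T = cst 1.
Proof. by exists fset0; exact: walsh0. Qed.

Let walsh_mul_closed S T : exists U, walsh S * walsh T = walsh U.
Proof. by exists (symdiff S T); exact: walsh_mul. Qed.

Let approx_sa : sigma_algebra setT approx.
Proof. exact: approx_set_sigma_algebra measurable_walsh walsh_le1 _ _. Qed.

Let approxC A : approx A -> approx (~` A).
Proof. by case: approx_sa => _ h _ /h; rewrite setTD. Qed.

Let approxI (A B : set W) : approx A -> approx B -> approx (A `&` B).
Proof.
by have /(sigma_algebraP (fun _ _ => @subsetT _ _))[_ _ _] := approx_sa; exact.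
Qed.

Let approxU (F : (set W)^nat) : (forall n, approx (F n)) -> approx (\bigcup_n F n).
Proof. by case: approx_sa => _ _; exact. Qed.

Let digit_set v m n : set W := [set w | digits m (w v) = n].

Let measurable_coord_set v (B : set I01) : measurable B ->
  measurable [set w : W | B (w v)].
Proof. by move=> mB; have := measurable_coord v measurableT mB; rewrite setTI. Qed.

Let approx_one v : approx [set w | unit_itv_val (w v) = 1].
Proof.
have mB : measurable [set x : I01 | unit_itv_val x = 1].
  by exists [set 1]; rewrite ?setTI.
apply: approx_set_null walsh_le1 _ _ _ _; [exact: measurable_walsh| | |].
- exact: walsh_one.
- exact: (measurable_coord_set v mB).
- have -> : [set w : W | unit_itv_val (w v) = 1] =
      box [:: v] (fun=> @unit_itv_val R @^-1` [set 1]).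
    apply/seteqP; split => w /=; first by move=> h j; rewrite /= inE => /eqP ->.
    by move=> h; apply: (h v); rewrite /= inE.
  rewrite mu_box// big_seq1 nu_unif// uniform_probE//.
  apply/eqP; rewrite -measure_le0; rewrite (_ : _ `&` _ = set0) ?measure0//.
  by apply/seteqP; split => x //= [->]; rewrite in_itv/= ltxx andbF.
Qed.

Let approx_odd v m : approx [set w | odd (digits m.+1 (w v))].
Proof.
split; first exact: measurable_coord_set (measurable_odd_digits R m.+1).
have -> : (\1_[set w : W | odd (digits m.+1 (w v))] : W -> R) =
    cst (2^-1) + (- 2^-1) *: walsh [fset (v, m)]%fset.
  apply/funext => w; rewrite -[RHS]/(2^-1 + (- 2^-1) * walsh [fset (v, m)]%fset w).
  rewrite /walsh big_seq_fset1/= rademacherE !indicE.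
  rewrite (_ : (w v \in _) = (w \in [set w : W | odd (digits m.+1 (w v))])).
    by field.
  by apply/idP/idP; rewrite !inE.
have wL : walsh [fset (v, m)]%fset \in Lfun mu 2%:E.
  exact: L2_bounded (measurable_walsh _) (walsh_le1 _).
apply: in_spanD measurable_walsh walsh_le1 _ _ _ _ _ _.
- exact: L2_cst.
- exact: L2Z.
- exact: in_span_cst.
- exact: (in_spanZ measurable_walsh walsh_le1 _ wL (in_span_phi _ _ _)).
Qed.

(** The indicator function of a binary digit is affine in a Walsh function, and the
    first [m] digits determine the integer part of [2 ^ m * x], except at the
    endpoint [x = 1], which has measure 0. *)
Let approx_digits v m n : approx (digit_set v m n).
Proof.
elim: m n => [|m IH] n.
  have dE w : digits 0 (w v) = (unit_itv_val (w v) == 1) :> nat.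
    apply/eqP; rewrite digits_eq expr0 mul1r; have /andP[v0 v1] := val01P (w v).
    have [->|ne] := eqVneq (unit_itv_val (w v)) 1; first by rewrite lexx ltr1n.
    by rewrite /= v0 lt_neqAle ne.
  have -> : digit_set v 0 n = match n with
      | 0 => ~` [set w | unit_itv_val (w v) = 1]
      | 1 => [set w | unit_itv_val (w v) = 1]
      | _ => set0 end.
    apply/seteqP; split => w; rewrite /digit_set /= dE.
      by case: n => [|[|n]] /=; case: eqP.
    by case: n => [|[|n]] //=; case: eqP.
  case: n => [|[|n]]; [apply: approxC| |]; try exact: approx_one.
  by case: approx_sa.
have -> : digit_set v m.+1 n = digit_set v m n./2 `&`
    (if odd n then [set w | odd (digits m.+1 (w v))]
     else ~` [set w | odd (digits m.+1 (w v))]).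
  apply/seteqP; split => w; rewrite /digit_set /= (digits_half m).
    move=> dn; split; first by rewrite dn.
    by case: ifP => /= nodd; rewrite dn nodd.
  move=> [h o]; rewrite -[LHS]odd_double_half -[RHS]odd_double_half h.
  by congr (_ + _)%N; move: o; case: (odd n) => /= [->|/negP/negbTE ->].
apply: approxI => //; case: ifP => _; last apply: approxC; exact: approx_odd.
Qed.

(** A ray is the union of the dyadic intervals that it contains. *)
Let approx_ray v (c : R) : approx [set w | unit_itv_val (w v) < c].
Proof.
have -> : [set w : W | unit_itv_val (w v) < c] =
    \bigcup_m \bigcup_n
      if n.+1%:R <= 2 ^+ m * c then digit_set v m n else set0.
  apply/seteqP; split => w /=.
    move=> wc; have d0 : 0 < c - unit_itv_val (w v) by rewrite subr_gt0.
    pose m := (Num.truncn (c - unit_itv_val (w v))^-1).+1.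
    exists m => //; exists (digits m (w v)) => //.
    have := eqxx (digits m (w v)); rewrite digits_eq => /andP[h1 h2].
    rewrite ifT// -natr1 (le_trans (lerD h1 (lexx 1)))//.
    rewrite -lerBrDl -mulrBr -ler_pdivrMr// mul1r.
    apply: le_trans (ltW (truncnS_gt _)) _.
    by rewrite -natrX ler_nat ltnW// ltn_expl.
  move=> [m _ [n _]]; case: ifP => // nc wn.
  have := eqxx (digits m (w v)); rewrite {2}wn digits_eq => /andP[_ h2].
  by rewrite -(ltr_pM2l (exprn_gt0 m (ltr0n R 2))) (lt_le_trans h2).
apply: approxU => m; apply: approxU => n; case: ifP => _.
  exact: approx_digits.
by case: approx_sa.
Qed.

Lemma approx_measurable A : measurable A -> approx A.
Proof.
apply: smallest_sub A; first exact: approx_sa.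
move=> A [v _ [_ [C mC <-] <-]]; rewrite !setTI.
have := sigma_algebra_image (fun w : W => unit_itv_val (w v)) approx_sa.
set G := image_set_system _ _ _ => saG.
suff : G C by rewrite /G /image_set_system /= setTI.
have : @measurable _ (measurableTypeR R) C by exact: mC.
rewrite RGenInftyO.measurableE; apply: smallest_sub; first exact: saG.
move=> _ [c ->]; rewrite /G /image_set_system /= setTI.
have -> : (fun w : W => unit_itv_val (w v)) @^-1` `]-oo, c[ =
    [set w | unit_itv_val (w v) < c] by apply/seteqP; split=> w /=; rewrite in_itv.
exact: approx_ray.
Qed.

Lemma walsh_dense f : f \in Lfun mu 2%:E -> in_span mu walsh f.
Proof.
move=> fL; apply: (in_span_L2 measurable_walsh walsh_le1 walsh_one) fL.
by move=> A /approx_measurable[].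
Qed.

End Walsh.

(** * Distributing the mass of a Fourier expansion over the tree *)

Lemma sum_sub_uniq (R : numDomainType) (I : eqType) (s t : seq I) (F : I -> R) :
  uniq s -> uniq t -> {subset s <= t} -> (forall i, 0 <= F i) ->
  \sum_(i <- s) F i <= \sum_(i <- t) F i.
Proof.
move=> us ut st F0; rewrite [leRHS](bigID (mem s))/=.
rewrite -[leLHS]addr0 lerD ?sumr_ge0// -[leRHS]big_filter.
rewrite (perm_big [seq i <- t | i \in s])//=.
apply: uniq_perm; rewrite ?filter_uniq// => i; rewrite mem_filter.
by case: (boolP (i \in s)) => // /st ->.
Qed.

Section Weight.
Context (R : realType) (V : choiceType).
Local Notation K := {fset V * nat}.
Implicit Types (T : K) (B D : set V) (g : V -> V).

(** For nonempty [T] this is a probability measure in [B]. *)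
Definition weight B T : R := (\sum_(p <- T) \1_B p.1) / #|` T|%:R.

Lemma weight_ge0 B T : 0 <= weight B T.
Proof. by rewrite divr_ge0// sumr_ge0. Qed.

Lemma card_fset_sumr T : #|` T|%:R = \sum_(p <- T) 1 :> R.
Proof. by rewrite card_fset_sum1 natr_sum. Qed.

Lemma weight_cover n (B_ : 'I_n -> set V) T : T != fset0 ->
  (forall v, exists i, B_ i v) -> 1 <= \sum_(i < n) weight (B_ i) T.
Proof.
move=> T0 cover; rewrite -mulr_suml ler_pdivlMr ?mul1r; last first.
  by rewrite ltr0n cardfs_gt0.
rewrite exchange_big/= card_fset_sumr; apply: ler_sum => p _.
have [i Bi] := cover p.1; rewrite (bigD1 i)//= indicE mem_set//= lerDl.
exact: sumr_ge0.
Qed.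

Definition translate g T : K := [fset (g p.1, p.2) | p in T]%fset.

Let pair_inj g : injective g -> injective (fun p : V * nat => (g p.1, p.2)).
Proof. by move=> gI [v i] [v' i'] /= [/gI -> ->]. Qed.

Lemma translate_inj g : injective g -> injective (translate g).
Proof.
move=> gI; have mem_tr T p : ((g p.1, p.2) \in translate g T) = (p \in T).
  by apply/imfsetP/idP => [[p' /= p'T /(pair_inj gI) ->]|pT] //; exists p.
by move=> T T' E; apply/fsetP => p; rewrite -[LHS]mem_tr -[RHS]mem_tr E.
Qed.

Lemma weight_translate g B T : injective g ->
  weight (g @` B) (translate g T) = weight B T.
Proof.
move=> gI; rewrite /weight card_imfset//=; last exact: pair_inj.
congr (_ / _); rewrite big_imfset/=; last by move=> ? ? _ _; exact: pair_inj.
apply: eq_bigr => p _; rewrite !indicE; congr (_ : bool)%:R.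
apply/idP/idP; rewrite !inE; first by move=> [v Bv /gI <-].
by move=> Bp; exists p.1.
Qed.

(** The bound on square sums is applied to the union of [s] and its translates.
    There the shares over the disjoint translates of [B] and over the complement of
    [D] add up to at most 1 for each [T], and by invariance of [c] each translate
    of [B] carries at least what [B] carries in [s]. *)
Lemma translates_mass (J : finType) (g : J -> V -> V) B D (c : K -> R) (N : R) :
  (forall j, injective (g j)) ->
  (forall j v, B v -> D (g j v)) ->
  (forall j j' v v', B v -> B v' -> g j v = g j' v' -> j = j') ->
  (forall j T, c (translate (g j) T) = c T) ->
  (forall s, uniq s -> \sum_(T <- s) c T ^+ 2 <= N) ->
  forall s, uniq s ->
    #|J|%:R * (\sum_(T <- s) weight B T * c T ^+ 2) +
    \sum_(T <- s) weight (~` D) T * c T ^+ 2 <= N.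
Proof.
move=> gI gD gdisj gc cN s us.
pose tr j := map (translate (g j)) s.
pose s' := undup (s ++ flatten [seq tr j | j <- enum J]).
have us' : uniq s' by exact: undup_uniq.
apply: le_trans (cN s' us'); rewrite mulr_natl -sumr_const.
have wc0 A T : 0 <= weight A T * c T ^+ 2.
  by rewrite mulr_ge0 ?weight_ge0 ?sqr_ge0.
apply: le_trans (_ : \sum_(j in J) \sum_(T <- s') weight (g j @` B) T * c T ^+ 2 +
    \sum_(T <- s') weight (~` D) T * c T ^+ 2 <= _).
  apply: lerD; last first.
    by apply: sum_sub_uniq => // T Ts; rewrite mem_undup mem_cat Ts.
  apply: ler_sum => j _.
  apply: le_trans (_ : \sum_(T <- tr j) weight (g j @` B) T * c T ^+ 2 <= _).
    rewrite big_map le_eqVlt; apply/orP; left; apply/eqP; apply: eq_bigr => T _.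
    by rewrite weight_translate// gc.
  apply: sum_sub_uniq => //.
    by rewrite map_inj_uniq//; exact: translate_inj.
  move=> T Tj; rewrite mem_undup mem_cat; apply/orP; right.
  by apply/flattenP; exists (tr j) => //; apply: map_f; rewrite mem_enum.
rewrite exchange_big/= -big_split/=; apply: ler_sum => T _.
rewrite -mulr_suml -mulrDl ler_piMl ?sqr_ge0// -mulr_suml -mulrDl.
have [->|T0] := eqVneq T fset0; first by rewrite cardfs0 invr0 mulr0.
rewrite ler_pdivrMr ?ltr0n ?cardfs_gt0// mul1r exchange_big/= -big_split/=.
rewrite card_fset_sumr; apply: ler_sum => p _; rewrite !indicE.
have [[j Bj]|noj] := pselect (exists j, (g j @` B) p.1).
  rewrite (bigD1 j)//= indicE mem_set//= big1 ?addr0 => [|j' j'j].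
    rewrite memNset ?addr0// => Dp; apply: Dp.
    by case: Bj => v Bv <-; exact: gD.
  rewrite indicE memNset// => -[v' Bv' E]; case: Bj => v Bv E'.
  by move/eqP: j'j; apply; apply: (gdisj _ _ v' v) => //; rewrite E E'.
rewrite big1 ?add0r => [|j _]; first by case: (_ \in _).
by rewrite indicE memNset// => Bj; apply: noj; exists j.
Qed.

End Weight.

(** * Correlation of invariant functions *)

Section Geodesic.
Context (V : choiceType) (e : rel V) (d : nat) (hT : is_regular_tree d e).
Variables (u : nat -> V) (k : nat).
Hypothesis u_edge : forall i, (i < k)%N -> e (u i) (u i.+1).
Hypothesis u_dist : dist hT (u 0%N) (u k) = k.

Let e_sym : symmetric e. Proof. by case: hT => -[]. Qed.

Lemma geodesic_dist i j : (i <= j <= k)%N -> dist hT (u i) (u j) = (j - i)%N.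
Proof.
move=> /andP[ij jk].
have up n m : (n + m <= k)%N -> (dist hT (u n) (u (n + m)) <= m)%N.
  elim: m => [|m IH]; first by rewrite addn0 distxx.
  rewrite addnS => nm; have := dist_step hT (u n) (u_edge nm).
  by have := IH (ltnW nm); lia.
have h1 := up 0%N i ltac:(lia); have h2 := up i (j - i)%N ltac:(lia).
have h3 := up j (k - j)%N ltac:(lia).
rewrite add0n in h1; rewrite !subnKC// in h2 h3.
have := dist_triangle hT (u i) (u 0%N) (u k).
have := dist_triangle hT (u j) (u i) (u k); rewrite u_dist; lia.
Qed.

(** The vertices whose nearest point on the path is [u i]. *)
Definition layer i : set V :=
  [set v | ((0 < i)%N -> side hT (u i.-1) (u i) v) /\
           ((i < k)%N -> side hT (u i.+1) (u i) v)].

(** A vertex [v] belongs to the layer of the vertex of the path nearest to [v]: the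
    two ends of an edge are never at the same distance from [v]. *)
Lemma layer_cover v : exists i : 'I_k.+1, layer i v.
Proof.
have [i _ imin] := @arg_minnP 'I_k.+1 ord0 predT (fun i => dist hT v (u i)) isT.
have ik : (i <= k)%N by have := ltn_ord i.
exists i; split=> [i0|ik']; rewrite sideE !(distC hT _ v) ltn_neqAle.
- rewrite (imin (Ordinal (ltnW _ : (i.-1 < k.+1)%N)))//; last by lia.
  rewrite andbT; apply/eqP => E; apply: (dist_edge_neq (a := v) _ (esym E)).
  by have := @u_edge i.-1; rewrite prednK//; apply; lia.
- have ik1 : (i.+1 < k.+1)%N by [].
  rewrite (imin (Ordinal ik1))// andbT; apply/eqP => E.
  exact: (dist_edge_neq (a := v) (u_edge ik') E).
Qed.

End Geodesic.

Section Fourier.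
Context (R : realType) (V : choiceType) (e : rel V) (d : nat)
  (hT : is_regular_tree d e).
Hypothesis d3 : (3 <= d)%N.
Local Notation W := (product_space V (I01 R)).
Variables (mu : probability W R) (nu : probability (I01 R) R).
Hypothesis mu_box : forall (s : seq V) (B : V -> set (I01 R)), uniq s ->
  (forall i, i \in s -> measurable (B i)) ->
  mu (box s B) = (\prod_(i <- s) nu (B i))%E.
Hypothesis nu_unif : forall B : set R, measurable B ->
  nu (@unit_itv_val R @^-1` B) = uniform_prob (@ltr01 R) B.
Implicit Types f : W -> R.

Let e_sym : symmetric e. Proof. by case: hT => -[]. Qed.

Local Notation coef := (fourier_coef mu (@walsh R V)).
Local Notation ip := (inner mu).

Definition fixes (A : set V) (g : graph_aut e) := forall v, A v -> g v = v.

Definition invariant_off (A : set V) f :=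
  forall g : graph_aut e, fixes A g -> forall w, f (aut_act g w) = f w.

(** The automorphism preserves the measure and carries [walsh T] to
    [walsh (translate g T)]. *)
Lemma fourier_coef_translate f (g : graph_aut e) T : measurable_fun setT f ->
  (forall w, f (aut_act g w) = f w) -> coef f (translate g T) = coef f T.
Proof.
move=> mf fg; rewrite /fourier_coef.
rewrite -(inner_preserving (@measurable_aut_act R V e g)
  (aut_act_preserving mu_box g) mf (measurable_walsh _)).
rewrite (_ : f \o _ = f); last by apply/funext => w /=.
congr inner; apply/funext => w; rewrite /walsh/= big_imfset/=; last first.
  by move=> [v i] [v' i'] _ _ /= [/(can_inj (@aut_funK _ _ g)) -> ->].
by apply: eq_bigr => p _; rewrite /aut_act aut_funK.
Qed.

(** [translates_mass] for the automorphisms of [branch_translates], where Bessel's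
    inequality bounds the square sums of the coefficients. *)
Lemma branch_mass f (a b x y : V) (m : nat) (B : set V) s :
  f \in Lfun mu 2%:E -> e a b -> e x y ->
  dist hT a x = m -> dist hT a y = m.+1 -> dist hT b y = m ->
  invariant_off (side hT b a) f -> B `<=` side hT x y -> uniq s ->
  d.-1%:R ^+ m * (\sum_(T <- s) weight R B T * coef f T ^+ 2) +
  \sum_(T <- s) weight R (side hT b a) T * coef f T ^+ 2 <= ip f f.
Proof.
move=> fL ab xy ax ay bye finv Bxy us.
have [g [gfix gside gdisj]] := branch_translates (hT := hT) (ltnW d3) ab xy ax ay bye.
have -> : side hT b a = ~` side hT a b.
  by apply/seteqP; split => v /=; [move/(sideN hT _ ab)|move=> h; apply/(sideN hT _ ab)].
have -> : d.-1%:R ^+ m = #|{: m.-tuple 'I_d.-1}|%:R :> R.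
  by rewrite card_tuple card_ord natrX.
apply: (@translates_mass R V _ (fun t => g t)) => //.
- by move=> t; exact: can_inj (@aut_funK _ _ _).
- by move=> t v /Bxy; exact: gside.
- by move=> t t' v v' /Bxy Bv /Bxy; exact: gdisj.
- move=> t T; apply: fourier_coef_translate; first exact: L2_measurable fL.
  by apply: finv => v; exact: gfix.
- move=> s' us'; apply: bessel => //.
    by move=> T; apply: (@L2_bounded _ _ _ _ 1) => [|w];
      [exact: measurable_walsh|rewrite norm_walsh].
  exact: walsh_orthonormal mu_box nu_unif.
Qed.

(** The layer of [u i.+1] lies in a branch at depth [i] below [u 1], which
    [branch_mass] controls for [f1] from the end [u 0]; for [f2] the path is seen
    from the end [u k]. *)
Lemma invariant_correlation f1 f2 (u : nat -> V) (k : nat) : (0 < k)%N ->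
  (forall i, (i < k)%N -> e (u i) (u i.+1)) -> dist hT (u 0%N) (u k) = k ->
  f1 \in Lfun mu 2%:E -> f2 \in Lfun mu 2%:E -> ('E_mu[f1] = 0)%E ->
  invariant_off (side hT (u 1%N) (u 0%N)) f1 ->
  invariant_off (side hT (u k.-1) (u k)) f2 ->
  `|ip f1 f2| <= k%:R * (d%:R - 1) * (1 / Num.sqrt (d%:R - 1)) ^+ k *
    Num.sqrt (ip f1 f1 * ip f2 f2).
Proof.
move=> k0 ue ud f1L f2L f10 inv1 inv2.
have walshL T : walsh T \in Lfun mu 2%:E.
  apply: (@L2_bounded _ _ _ _ 1) => [|w]; first exact: measurable_walsh.
  by rewrite norm_walsh.
have qE : d%:R - 1 = d.-1%:R :> R.
  by rewrite -[in LHS](prednK (leq_trans (isT : 0 < 3)%N d3)) -natr1 addrK.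
have gd := geodesic_dist ue ud.
apply/ler_addgt0Pl => eps eps0.
have [s us hs] := parseval walshL (walsh_orthonormal mu_box nu_unif) f1L f2L
  (walsh_dense mu_box nu_unif f1L) eps0.
have := ler_normD (ip f1 f2 - \sum_(T <- s) coef f1 T * coef f2 T)
  (\sum_(T <- s) coef f1 T * coef f2 T).
rewrite subrK => /le_trans; apply; apply: lerD hs _.
pose al i := \sum_(T <- s) weight R (layer hT u k i) T * coef f1 T ^+ 2.
pose be i := \sum_(T <- s) weight R (layer hT u k i) T * coef f2 T ^+ 2.
(* The empty set has no share in any layer, but its coefficient is the mean. *)
have coef0 : coef f1 fset0 = 0.
  rewrite /fourier_coef /inner walsh0 (_ : f1 * cst 1 = f1) ?f10//.
  by apply/funext => w; exact: mulr1.
apply: le_trans (_ : \sum_(i < k.+1) Num.sqrt (al i * be i) <= _).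
  apply: le_trans (ler_norm_sum _ _ _) _.
  apply: le_trans (_ : \sum_(T <- s) \sum_(i < k.+1)
      weight R (layer hT u k i) T * (`|coef f1 T| * `|coef f2 T|) <= _).
    apply: ler_sum => T _; rewrite -mulr_suml normrM.
    have [->|T0] := eqVneq T fset0; first by rewrite coef0 normr0 mul0r mulr0.
    by rewrite ler_peMl ?mulr_ge0// weight_cover// => v; exact: layer_cover.
  rewrite exchange_big/=; apply: ler_sum => i _.
  have := @weighted_cauchy_schwarz R _ s (weight R (layer hT u k i))
    (fun T => `|coef f1 T|) (fun T => `|coef f2 T|) (weight_ge0 R _).
  by congr (_ <= Num.sqrt (_ * _)); apply: eq_bigr => T _;
    rewrite real_normK// num_real.
rewrite qE; apply: layer_sum_bound => //.
- by rewrite ler1n; lia.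
- by move=> i; apply: sumr_ge0 => T _; rewrite mulr_ge0 ?weight_ge0 ?sqr_ge0.
- by move=> i; apply: sumr_ge0 => T _; rewrite mulr_ge0 ?weight_ge0 ?sqr_ge0.
- move=> i ik; have -> : al 0%N = \sum_(T <- s)
      weight R (side hT (u 1%N) (u 0%N)) T * coef f1 T ^+ 2.
    apply: eq_bigr => T _; congr (weight R _ T * _).
    by apply/seteqP; split => v; [move=> [_ /(_ k0)]|move=> h; split].
  apply: (@branch_mass _ _ _ (u i) (u i.+1)) => //.
  + exact: ue.
  + exact: ue.
  + by rewrite gd ?subn0//; lia.
  + by rewrite gd ?subn0//; lia.
  + by rewrite gd ?subn1//; lia.
  + by move=> v [/(_ isT)].
- move=> i ik; have -> : be k = \sum_(T <- s)
      weight R (side hT (u k.-1) (u k)) T * coef f2 T ^+ 2.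
    apply: eq_bigr => T _; congr (weight R _ T * _).
    by apply/seteqP; split => v; [move=> [/(_ k0)]|move=> h; split=> //; rewrite ltnn].
  apply: (@branch_mass _ _ _ (u i.+1) (u i)) => //.
  + by rewrite e_sym; have := ue k.-1; rewrite prednK//; apply; lia.
  + by rewrite e_sym ue.
  + by rewrite distC gd; lia.
  + by rewrite distC gd; lia.
  + by rewrite distC gd; lia.
  + by move=> v [_ /(_ ik)].
Qed.

End Fourier.

(** * Factors of i.i.d. processes *)

Section Centering.
Context (R : realType) (dO dT : measure_display) (Omega : measurableType dO)
  (T : measurableType dT).
Variables (P : probability Omega R) (mu : probability T R) (Z : Omega -> T).
Hypothesis mZ : measurable_fun setT Z.
Hypothesis law : forall A, measurable A -> P (Z @^-1` A) = mu A.
Variable phi : T -> R.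
Hypothesis mphi : measurable_fun setT phi.

Definition centered : T -> R := phi - cst (fine 'E_P[phi \o Z]).

Lemma measurable_centered : measurable_fun setT centered.
Proof. exact: measurable_funB. Qed.

Lemma centered_variance : ('V_P[phi \o Z] = 'E_mu[centered * centered])%E.
Proof.
rewrite -(expectation_preserving mZ law); last first.
  by apply: measurable_funM; exact: measurable_centered.
by rewrite /variance unlock.
Qed.

Hypothesis varoo : ('V_P[phi \o Z] < +oo)%E.

Lemma centered_L2 : centered \in Lfun mu 2%:E.
Proof.
apply: integrable_sqr_L2 measurable_centered _.
have := varoo; rewrite centered_variance unlock; apply: le_lt_trans.
by rewrite le_eqVlt; apply/orP; left; apply/eqP; apply: eq_integral => x _; rewrite expr2.
Qed.

Lemma centered_mean0 : ('E_mu[centered] = 0)%E.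
Proof.
have c1 : centered \in Lfun mu 1 by exact: L2_Lfun1 centered_L2.
have phiE : phi = centered + cst (fine 'E_P[phi \o Z]) by rewrite subrK.
have phi1 : phi \in Lfun mu 1.
  by apply: L2_Lfun1; rewrite phiE; apply: L2D; [exact: centered_L2|exact: L2_cst].
have cL : cst (fine 'E_P[phi \o Z]) \in Lfun mu 1 by exact/L2_Lfun1/L2_cst.
rewrite (expectationB phi1 cL) expectation_cst.
by rewrite (expectation_preserving mZ law mphi) fineK ?subee ?expectation_fin_num.
Qed.

End Centering.

Lemma centered_covariance (R : realType) (dO dT : measure_display)
    (Omega : measurableType dO) (T : measurableType dT)
    (P : probability Omega R) (mu : probability T R) (Z : Omega -> T)
    (phi psi : T -> R) :
  measurable_fun setT Z ->
  (forall A, measurable A -> P (Z @^-1` A) = mu A) ->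
  measurable_fun setT phi -> measurable_fun setT psi ->
  covariance P (phi \o Z) (psi \o Z) =
  ('E_mu[centered P Z phi * centered P Z psi])%E.
Proof.
move=> mZ law mphi mpsi; rewrite -(expectation_preserving mZ law); last first.
  by apply: measurable_funM; exact: measurable_centered.
by rewrite unlock.
Qed.

Theorem theorem1p1 (R : realType) (d : nat) (hd : (3 <= d)%N)
    (V : choiceType) (e : rel V) (hT : is_regular_tree d e)
    (dM : measure_display) (M : measurableType dM)
    (dO : measure_display) (Omega : measurableType dO) (P : probability Omega R)
    (X : Omega -> product_space V M) (hX : is_factor_of_iid P e X)
    (V1 V2 : set V)
    (h1 : product_space V1 M -> R) (h2 : product_space V2 M -> R)
    (mh1 : measurable_fun setT h1) (mh2 : measurable_fun setT h2)
    (H1 H2 : subgraph e)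
    (hH1 : is_convex_hull V1 H1) (hH2 : is_convex_hull V2 H2)
    (k : nat) (hk : is_subgraph_dist H1 H2 k) (k_gt0 : (0 < k)%N) :
  let Y1 := fun t : Omega => h1 (coord_restrict V1 (X t)) in
  let Y2 := fun t : Omega => h2 (coord_restrict V2 (X t)) in
  ('V_P[Y1] < +oo)%E -> ('V_P[Y2] < +oo)%E ->
  `|corr P Y1 Y2| <= k%:R * (d%:R - 1) * (1 / Num.sqrt (d%:R - 1)) ^+ k.
Proof.
move=> Y1 Y2 var1 var2.
have [F [Z [[mF Feq] [Zind Zunif] XE]]] := hX.
have [[x [y [H1x H2y gxy]]] kmin] := hk.
have [conn1 sub1 _] := hH1; have [conn2 sub2 _] := hH2.
have e_sym : symmetric e by case: hT => -[].
pose W := product_space V (I01 R).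
pose Zf (t : Omega) : W := fun v => Z v t.
have mZ : measurable_fun setT Zf.
  by apply: measurable_to_product => v; exact: measurable_funP.
pose ZRV : {mfun Omega >-> W} := mfun_Sub (mem_set mZ).
pose mu : probability W R := distribution P ZRV.
have law (A : set W) : measurable A -> P (Zf @^-1` A) = mu A by [].
pose nu : probability (I01 R) R := distribution P (Z x).
have nu_unif (B : set R) : measurable B ->
    nu (@unit_itv_val R @^-1` B) = uniform_prob (@ltr01 R) B.
  by move=> mB; exact: Zunif.
have mu_box (s : seq V) (B : V -> set (I01 R)) : uniq s ->
    (forall i, i \in s -> measurable (B i)) ->
    mu (box s B) = (\prod_(i <- s) nu (B i))%E.
  move=> us mB; rewrite -[LHS]/(P (\bigcap_(i in [set` s]) (Z i @^-1` B i))).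
  rewrite Zind//; apply: eq_big_seq => i /mB [C mC <-]; rewrite setTI.
  by rewrite [RHS]nu_unif// -(Zunif i).
have [[p [xp lp sp]] _] := gxy.
pose u i := nth x (x :: p) i.
have u0 : u 0%N = x by [].
have uk : u k = y by rewrite -lp -sp /u -[size p]/((size (x :: p)).-1) nth_last.
have ue i : (i < k)%N -> e (u i) (u i.+1).
  by rewrite -sp => /(pathP x xp i).
have ud : dist hT (u 0%N) (u k) = k by rewrite u0 uk -(graph_distE hT gxy).
have gd := geodesic_dist ue ud.
(* The vertex of the path next to a hull is closer to the other hull than [k],
   so it does not belong to the first one. *)
have side1 : V1 `<=` side hT (u 1%N) (u 0%N).
  apply: subset_trans sub1 _; apply: connected_side conn1 _ _ _ => //.
    exact: ue.
  move=> H1u; have := kmin _ _ _ H1u H2y (dist_is_graph_dist hT _ _).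
  by rewrite -uk gd; lia.
have side2 : V2 `<=` side hT (u k.-1) (u k).
  apply: subset_trans sub2 _; apply: connected_side conn2 _ _ _.
  - by rewrite e_sym; have := ue k.-1; rewrite prednK//; apply; lia.
  - by rewrite uk.
  - move=> H2u; have := kmin _ _ _ H1x H2u (dist_is_graph_dist hT _ _).
    by rewrite -u0 gd; lia.
have obs_meas (A : set V) (h : product_space A M -> R) :
    measurable_fun setT h ->
    measurable_fun setT (fun w : W => h (coord_restrict A (F w))).
  move=> mh; apply: (measurableT_comp mh).
  exact: (measurableT_comp (@measurable_coord_restrict _ A _ M) mF).
have obs_inv (A S : set V) (h : product_space A M -> R) : A `<=` S ->
    invariant_off e S (centered P Zf (fun w : W => h (coord_restrict A (F w)))).
  move=> AS g gS w; rewrite -[LHS]/(h _ - _) -[RHS]/(h _ - _); congr (h _ - _).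
  rewrite Feq; apply/funext => v; rewrite /coord_restrict /aut_act.
  congr (F w _); rewrite -[in LHS](gS (val v)) ?aut_funK//.
  by apply: AS; exact: set_valP.
pose phi1 (w : W) := h1 (coord_restrict V1 (F w)).
pose phi2 (w : W) := h2 (coord_restrict V2 (F w)).
have Y1E : Y1 = phi1 \o Zf by apply/funext => t; rewrite /Y1 XE.
have Y2E : Y2 = phi2 \o Zf by apply/funext => t; rewrite /Y2 XE.
have m1 : measurable_fun setT phi1 by exact: obs_meas.
have m2 : measurable_fun setT phi2 by exact: obs_meas.
rewrite Y1E in var1; rewrite Y2E in var2.
have L1 := centered_L2 mZ law m1 var1.
have L2 := centered_L2 mZ law m2 var2.
have main := invariant_correlation hd mu_box nu_unif k_gt0 ue ud L1 L2
  (centered_mean0 mZ law m1 var1) (obs_inv _ _ _ side1) (obs_inv _ _ _ side2).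
have bound0 : 0 <= k%:R * (d%:R - 1) * (1 / Num.sqrt (d%:R - 1)) ^+ k :> R.
  have d1 : 0 <= d%:R - 1 :> R by rewrite subr_ge0 ler1n; lia.
  by rewrite !mulr_ge0// exprn_ge0// divr_ge0// sqrtr_ge0.
rewrite /corr Y1E Y2E !(centered_variance mZ law)//.
rewrite (centered_covariance mZ law)//.
case: ifP => [_|/negbT]; first by rewrite normr0.
rewrite negb_or => /andP[v1 v2].
set f1 := centered P Zf phi1 in L1 main v1 *.
set f2 := centered P Zf phi2 in L2 main v2 *.
have pos (f : W -> R) : f \in Lfun mu 2%:E -> 'E_mu[f * f]%E != 0%E ->
    0 < inner mu f f.
  move=> fL f0; rewrite lt_neqAle inner_ge0 andbT eq_sym.
  by apply: contra f0 => /eqP E; rewrite -(fineK (expectation_fin_num (L2M fL fL))) [fine _]E.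
have p1 := pos _ L1 v1; have p2 := pos _ L2 v2.
rewrite -/(inner mu f1 f2) -/(inner mu f1 f1) -/(inner mu f2 f2).
rewrite normrM normfV (ger0_norm (sqrtr_ge0 (_ * _))).
by rewrite ler_pdivrMr// sqrtr_gt0 mulr_gt0.
Qed.
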